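(* For every $p\in(1,2)$ and every $u\in W^{\frac1p,p}(\mathbb{S}^1,\mathbb{S}^1)$, $$|\deg u|\ \le\ \frac{p-1}{4\pi}\,E_{1/p}(u).$$
   Context: $\mathbb{S}^1$ is the unit circle in $\mathbb{C}$. For $1<p<\infty$ and $u\colon\mathbb{S}^1\to\mathbb{S}^1$ measurable, $$E_{1/p}(u)=\int_{\mathbb{S}^1}\int_{\mathbb{S}^1}\frac{|u(x)-u(y)|^p}{|x-y|^2}\,dx\,dy,$$ where $dx,dy$ denote arclength measure and $|x-y|$ is the distance in $\mathbb{C}$. $W^{\frac1p,p}(\mathbb{S}^1,\mathbb{S}^1)$ is the set of measurable $u\colon\mathbb{S}^1\to\mathbb{S}^1$ with $E_{1/p}(u)<\infty$. The degree of such $u$ is the standard (VMO) degree, i.e. the continuous extension of the topological degree from smooth maps, which are dense. *)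

(* Defs.v *)
(* MathComp-Analysis, with the complex numbers R[i] of real-closed. *)
From mathcomp Require Import all_boot all_order all_algebra.
From mathcomp Require Import complex.
From mathcomp Require Import all_classical all_reals all_analysis.
Import Order.TTheory GRing.Theory Num.Theory ComplexField.
Import numFieldNormedType.Exports.

Set Implicit Arguments.
Unset Strict Implicit.
Unset Printing Implicit Defensive.

Local Open Scope classical_set_scope.
Local Open Scope ring_scope.
Local Open Scope complex_scope.

(* [normc] is the R-valued modulus; `|z| would be R[i]-valued. *)
Definition circle (R : realType) := {z : R[i] | Normc.normc z == 1}.

Lemma normc_expi (R : realType) (t : R) :
  Normc.normc (cos t +i* sin t) == 1.
Proof. by rewrite /= cos2Dsin2 sqrtr1. Qed.

Definition expi (R : realType) (t : R) : circle R :=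
  exist (fun z : R[i] => Normc.normc z == 1) _ (normc_expi t).

(* R with the sigma-algebra of Lebesgue measurable (not just Borel) sets, the
   domain of [completed_lebesgue_measure]. *)
Definition lebesgueR (R : realType) :=
  caratheodory_type ((wlength (idfun : R -> R))^*)%mu.

(* Integral over the circle with respect to arclength, which is the image of
   the Lebesgue measure on [0, 2 pi] under t |-> e^(it). *)
Definition circle_integral (R : realType) (f : circle R -> \bar R) : \bar R :=
  \int[@completed_lebesgue_measure R]_(t in `[0%R, 2 * pi]) f (expi t).

Definition circle_measurable (R : realType) (u : circle R -> circle R) :=
  measurable_fun [set: lebesgueR R]
    ((fun t : R => complex.Re (val (u (expi t)))) : lebesgueR R -> R) /\
  measurable_fun [set: lebesgueR R]
    ((fun t : R => complex.Im (val (u (expi t)))) : lebesgueR R -> R).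

(* p-th power of the Gagliardo seminorm of W^(1/p,p). On the diagonal x = y the
   integrand is 0 / 0 = 0. *)
Definition gagliardo (R : realType) (p : R) (f : circle R -> R[i]) : \bar R :=
  circle_integral (fun x => circle_integral (fun y =>
    (Normc.normc (f x - f y) `^ p / Normc.normc (val x - val y) ^+ 2)%:E)).

Definition energy (R : realType) (p : R) (u : circle R -> circle R) : \bar R :=
  gagliardo p (fun x => val (u x)).

Definition W_circle (R : realType) (p : R) : set (circle R -> circle R) :=
  [set u | circle_measurable u /\ (energy p u < +oo)%E].

(* p-th power of the W^(1/p,p) distance: || u - v ||_p^p + [u - v]^p. *)
Definition W_dist (R : realType) (p : R) (u v : circle R -> circle R) :
    \bar R :=
  (circle_integral (fun x => (Normc.normc (val (u x) - val (v x))%R `^ p)%:E)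
   + gagliardo p (fun x => val (u x) - val (v x))%R)%E.

Definition circle_smooth (R : realType) (v : circle R -> circle R) :=
  forall (n : nat) (t : R),
    derivable (derive1n n (fun s : R => complex.Re (val (v (expi s))))) t 1 /\
    derivable (derive1n n (fun s : R => complex.Im (val (v (expi s))))) t 1.

(* Topological degree of a continuous map, through a lifting. *)
Definition is_degree (R : realType) (v : circle R -> circle R) (d : int) :=
  exists phi : R -> R,
    [/\ continuous phi,
        forall t, v (expi t) = expi (phi t) &
        phi (2 * pi) - phi 0 = 2 * pi * d%:~R].

(* d is the limit of deg v as v tends to u in W^(1/p,p) among smooth maps: u is
   approximable by smooth maps and, Z being discrete, all smooth maps close
   enough to u have degree d. *)
Definition is_vmo_degree (R : realType) (p : R) (u : circle R -> circle R)
    (d : int) :=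
  (forall e : R, 0 < e ->
    exists2 v, circle_smooth v & (W_dist p u v < e%:E)%E) /\
  (exists2 e : R, 0 < e &
    forall v, circle_smooth v -> (W_dist p u v < e%:E)%E -> is_degree v d).

(* Continuous extension of the degree from smooth maps to W^(1/p,p). By density
   of the smooth maps and continuity of the degree, the default value 0 is never
   used for u in W^(1/p,p), 1 < p. *)
Definition vmo_degree (R : realType) (p : R) (u : circle R -> circle R) : int :=
  xget 0 [set d | is_vmo_degree p u d].

(* Main.v *)
Require Import Defs.
From HB Require Import structures.
From mathcomp Require Import all_boot all_order all_algebra.
From mathcomp Require Import complex.
From mathcomp Require Import all_classical all_reals all_analysis.
From mathcomp Require Import measurable_realfun.
From mathcomp Require Import ring lra.
Import Order.TTheory GRing.Theory Num.Theory.
Import numFieldNormedType.Exports.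
Local Open Scope classical_set_scope.
Local Open Scope ring_scope.

(** With [e = p - 1], let [f = dist_angle] be the function of a real angle equal to
[x * |2 sin (x / 2)|^e] on [[-pi, pi]] and increasing by [2 pi * 2^e] over a
period.  It is almost additive:
[[
  |f (x + y) - f x - f y| <= e ln 2 * 2^e * (|2 sin (x/2)|^p + |2 sin (y/2)|^p).
]]
The three angles [x], [y], [- (x + y)] are the arcs cut by three points of the
circle, and the estimate reduces to inequalities between the half angles
(obtuse and acute case) that follow from [ln s <= s - 1] and [x cos x <= sin x].

Let [phi] be a continuous lifting of a map of degree [d] and
[J t = \int |v (a + t) - v a|^p da].  Halving [t] repeatedly in
[f (phi (a + t) - phi a)], which is [2^e d t + O(1)] for large [t] and
[O(|v (a + t) - v a|^p)] for small [t], and averaging over [a] and over [t] in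
[[T, 2T]] with weight [t^-2] gives, as [T] tends to infinity,
[[
  2 pi * 2^e |d| ln 2 <= e ln 2 * 2^e * \int_0^oo J t / t^2 dt.
]]
Since [J] is even and [2 pi]-periodic and [1 / (4 sin^2 (t/2))] is the sum of the
[(t + 2 pi j)^-2], the last integral is half of the energy.  The kernel identity
is used through [K x + K (pi - x) = 4 K (2 x)] for [K = 1 / (4 sin^2 (x/2))], so
that only finitely many terms occur.

For a general map the bound passes to the limit along smooth approximations,
since [|a + b|^p <= l^(1-p) |a|^p + (1-l)^(1-p) |b|^p] for [0 < l < 1]. *)

(** * Elementary inequalities *)

Lemma is_derive_ge0_le (R : realType) (f df : R -> R) (a b : R) :
  (forall x : R, is_derive x (1 : R) f (df x)) -> (forall x, a <= x <= b -> 0 <= df x) ->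
  a <= b -> f a <= f b.
Proof.
move=> fd df0 ab.
have [c cab E] := MVT_segment ab (fun x _ => fd x)
  (derivable_within_continuous (fun x _ => @ex_derive _ _ _ _ _ _ _ (fd x))).
by rewrite -subr_ge0 E mulr_ge0 ?subr_ge0 // df0 // -in_itv.
Qed.

Lemma sin_le_id (R : realType) (x : R) : 0 <= x -> sin x <= x.
Proof.
move=> x0; rewrite -subr_ge0.
have := @is_derive_ge0_le R (fun y => y - sin y) (fun y => 1 - cos y) 0 x.
by rewrite sin0 subrr; apply=> // y _; rewrite subr_ge0 cos_le1.
Qed.

Lemma sqr_sin_le (R : realType) (x : R) : sin x ^+ 2 <= x ^+ 2.
Proof.
wlog x0 : x / 0 <= x.
  move=> H; case: (lerP 0 x) => [/H//|/ltW]; rewrite -oppr_ge0 => /H.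
  by rewrite sinN !sqrrN.
have [xpi|] := lerP x 1.
  rewrite ler_sqr ?nnegrE ?sin_le_id // sin_ge0_pi // x0 /=.
  by rewrite (le_trans xpi) // (le_trans _ (pi_ge2 R)) // ler1n.
move=> x1; apply: (@le_trans _ _ 1); last by rewrite expr_ge1 // ltW.
by rewrite -[leLHS]ger0_norm ?sqr_ge0 // normrX expr_le1 // sin_max.
Qed.

Lemma mul_cos_le_sin (R : realType) (x : R) : 0 <= x <= pi -> x * cos x <= sin x.
Proof.
case/andP => x0 xpi; rewrite -subr_ge0.
have := @is_derive_ge0_le R (fun y => sin y - y * cos y) (fun y => y * sin y) 0 x.
rewrite sin0 mul0r subrr; apply=> // [y|y].
  by apply: is_derive_eq; rewrite /GRing.scale /=; ring.
by case/andP => y0 yx; rewrite mulr_ge0 // sin_ge0_pi // y0 (le_trans yx).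
Qed.

Lemma ln_leB1 (R : realType) (x : R) : 0 < x -> ln x <= x - 1.
Proof.
move=> x0; have := @le_ln1Dx R (x - 1); rewrite addrCA subrr addr0.
by apply; rewrite ltrBDr addrC subrr.
Qed.

(** Factoring out b^e leaves 1 - exp (-s) <= s with s = e ln (b/a). This is where the factor e = p -
    1 of the theorem enters. *)
Lemma powRB_le_ln (R : realType) (e a b : R) : 0 < a -> 0 < b ->
  b `^ e - a `^ e <= b `^ e * (e * ln (b / a)).
Proof.
move=> a0 b0; rewrite ln_div ?posrE //.
have -> : a `^ e = b `^ e * expR (- (e * (ln b - ln a))).
  by rewrite /powR !gt_eqF // -expRD; congr expR; ring.
rewrite -{1}(mulr1 (b `^ e)) -mulrBr ler_wpM2l ?powR_ge0 //.
have := expR_ge1Dx (- (e * (ln b - ln a))); lra.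
Qed.

(** Convexity of x^p at the points a/l and b/(1-l), with weights l and 1-l. *)
Lemma powRD_le_weighted (R : realType) (p l a b : R) :
  1 <= p -> 0 < l < 1 -> 0 <= a -> 0 <= b ->
  (a + b) `^ p <= l `^ (1 - p) * a `^ p + (1 - l) `^ (1 - p) * b `^ p.
Proof.
move=> p1 /andP[l0 l1] a0 b0; have l10 : 0 < 1 - l by rewrite subr_gt0.
have K (t c : R) : 0 < t -> 0 <= c -> t * (c / t) `^ p = t `^ (1 - p) * c `^ p.
  move=> t0 c0; rewrite powRM ?invr_ge0 ?(ltW t0) // -powR_inv1 ?(ltW t0) //.
  rewrite -powRrM mulrCA mulrC; congr (_ * _).
  rewrite -{1}(powRr1 (ltW t0)) -powRD ?mulN1r //.
  by rewrite (gt_eqF t0) implybT.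
have := @convex_powR R p p1 (Itv01 (ltW l0) (ltW l1)) (a / l) (b / (1 - l)).
rewrite !inE /= !in_itv /= !andbT !divr_ge0 ?(ltW l0) ?(ltW l10) //.
move=> /(_ isT isT) H; rewrite -!K //; apply: le_trans H.
rewrite [X in _ <= X `^ _]convRE /= /unstable.onem.
by rewrite [l * _]mulrC [(1 - l) * _]mulrC !divfK ?gt_eqF.
Qed.

Lemma powRD_le (R : realType) (p a b : R) : 1 <= p -> 0 <= a -> 0 <= b ->
  (a + b) `^ p <= 2 `^ (p - 1) * (a `^ p + b `^ p).
Proof.
move=> p1 a0 b0; have h : 0 < (2^-1 : R) < 1 by lra.
have := powRD_le_weighted _ _ _ _ _ p1 h a0 b0.
have -> : (1 - 2^-1 : R) = 2^-1 by lra.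
rewrite -mulrDr -powR_inv1 // -powRrM.
by have -> : -1 * (1 - p) = p - 1 by ring.
Qed.

(** Gibbs' inequality against two equal weights (a+b)/2: apply ln s <= s - 1 at s = (a+b)/(2c) for c
    = a and c = b; the right-hand sides cancel in the sum. *)
Lemma xlnx_pair_le (R : realType) (a b : R) : 0 < a -> 0 < b ->
  - (a * ln a + b * ln b) <= (a + b) * ln 2 - (a + b) * ln (a + b).
Proof.
move=> a0 b0; have ab0 : 0 < a + b by rewrite addr_gt0.
have K (c : R) : 0 < c -> c * (ln (a + b) - ln 2 - ln c) <= (a + b) / 2 - c.
  move=> c0; have q0 : 0 < (a + b) / (2 * c) by rewrite divr_gt0 // mulr_gt0.
  have := ln_leB1 _ _ q0; rewrite ln_div ?lnM ?posrE ?mulr_gt0 // => H.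
  apply: (@le_trans _ _ (c * ((a + b) / (2 * c) - 1))).
    by rewrite ler_wpM2l ?(ltW c0) //; lra.
  rewrite le_eqVlt; apply/orP; left; apply/eqP; field.
  by rewrite gt_eqF.
have := K _ a0; have := K _ b0; nra.
Qed.

(** Split each weight as A = sin A + (A - sin A). The sine parts give the ln 2 term plus at most sin
    (A+B) - sin A - sin B (by [J] and [JS]), and the remainders give at most sin B (1 - cos A) + sin
    A (1 - cos B) (by [K]). The addition formula makes all but the ln 2 term cancel. *)
Lemma sin_ln_obtuse (R : realType) (A B : R) : 0 < A -> 0 < B ->
  A + B <= pi / 2 ->
  A * ln (sin (A + B) / sin A) + B * ln (sin (A + B) / sin B) <=
  ln 2 * (sin A + sin B).
Proof.
move=> A0 B0 AB; have pi0 := pi_gt0 R.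
have sA0 : 0 < sin A by apply: sin_gt0_pi; lra.
have sB0 : 0 < sin B by apply: sin_gt0_pi; lra.
have S0 : 0 < sin (A + B) by apply: sin_gt0_pi; lra.
have sig0 : 0 < sin A + sin B by rewrite addr_gt0.
have J := xlnx_pair_le _ _ _ sA0 sB0.
have q0 : 0 < sin (A + B) / (sin A + sin B) by rewrite divr_gt0.
have JS : (sin A + sin B) * (ln (sin (A + B)) - ln (sin A + sin B)) <=
    sin (A + B) - (sin A + sin B).
  have := ln_leB1 _ _ q0; rewrite ln_div ?posrE // => H.
  apply: (le_trans (ler_wpM2l (ltW sig0) H)).
  by rewrite mulrBr mulr1 mulrCA divff ?gt_eqF // mulr1.
(* From ln s <= s - 1 and cos D <= 1 the logarithm is at most cos C sin D / sin C; then C cos C <=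
   sin C removes the denominator. *)
have K (C D : R) : 0 < C -> 0 < D -> C + D <= pi / 2 ->
    (C - sin C) * ln (sin (C + D) / sin C) <= sin D * (1 - cos C).
  move=> C0 D0 CD.
  have sC0 : 0 < sin C by apply: sin_gt0_pi; lra.
  have sD0 : 0 < sin D by apply: sin_gt0_pi; lra.
  have sCD : 0 < sin (C + D) by apply: sin_gt0_pi; lra.
  have sCle : sin C <= C by rewrite sin_le_id ?ltW.
  have cC : C * cos C <= sin C by rewrite mul_cos_le_sin //; lra.
  have cC0 : 0 <= cos C by rewrite cos_ge0_pihalf //; lra.
  have cD1 := cos_le1 D.
  have := ln_leB1 _ _ (divr_gt0 sCD sC0) => H.
  have H2 : sin (C + D) / sin C - 1 <= cos C * sin D / sin C.
    rewrite -[X in _ - X](divff (lt0r_neq0 sC0)) -mulrBl ler_pM2r ?invr_gt0 // sinD.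
    nra.
  have H3 : (C - sin C) * ln (sin (C + D) / sin C) <=
            (C - sin C) * (cos C * sin D / sin C).
    by rewrite ler_wpM2l ?subr_ge0 // (le_trans H).
  apply: (le_trans H3).
  rewrite mulrA ler_pdivrMr //.
  have -> : (C - sin C) * (cos C * sin D) = sin D * (C * cos C - sin C * cos C) by ring.
  have -> : sin D * (1 - cos C) * sin C = sin D * (sin C - sin C * cos C) by ring.
  by rewrite ler_pM2l // lerB.
have KA := K _ _ A0 B0 AB.
have KB : (B - sin B) * ln (sin (A + B) / sin B) <= sin A * (1 - cos B).
  by rewrite (addrC A B); apply: K => //; rewrite addrC.
have E := sinD A B.
rewrite !ln_div ?posrE // in KA KB *.
lra.
Qed.

(** A and B are angles of a triangle whose third angle is at least pi/2. With S = sin (A+B), the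
    difference is A (S^e - (sin A)^e) + B (S^e - (sin B)^e), which [powRB_le_ln] reduces to
    [sin_ln_obtuse]. *)
Lemma sin_powR_obtuse (R : realType) (e A B : R) : 0 < e ->
  0 <= A -> 0 <= B -> A + B <= pi / 2 ->
  `|(A + B) * sin (A + B) `^ e - A * sin A `^ e - B * sin B `^ e| <=
  e * ln 2 * 2 `^ e * (sin A `^ (1 + e) + sin B `^ (1 + e)).
Proof.
move=> e0; have pi0 := pi_gt0 R; have ln20 : 0 < ln (2 : R) by rewrite ln_gt0 // ltr1n.
have rhs0 (x y : R) : 0 <= e * ln 2 * 2 `^ e * (x `^ (1 + e) + y `^ (1 + e)).
  by rewrite !mulr_ge0 ?addr_ge0 ?powR_ge0 ?ltW.
rewrite le_eqVlt => /predU1P[<-|A0].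
  by rewrite add0r mul0r subr0 subrr normr0 rhs0.
rewrite le_eqVlt => /predU1P[<-|B0] AB.
  by rewrite addr0 mul0r subr0 subrr normr0 rhs0.
have sA0 : 0 < sin A by apply: sin_gt0_pi; lra.
have sB0 : 0 < sin B by apply: sin_gt0_pi; lra.
have S0 : 0 < sin (A + B) by apply: sin_gt0_pi; lra.
have lesin (x y : R) : 0 < x -> 0 < y -> x + y <= pi / 2 -> sin x <= sin (x + y).
  move=> x0 y0 xy; rewrite -[leLHS]addr0 le_eqVlt; apply/orP; right.
  by rewrite addr0 ltr_sin ?in_itv /=; lra.
have SA := lesin _ _ A0 B0 AB.
have SB : sin B <= sin (A + B) by rewrite addrC lesin // addrC.
have PA : sin A `^ e <= sin (A + B) `^ e.
  by rewrite ge0_ler_powR ?nnegrE ?(ltW e0) ?(ltW sA0) ?(ltW S0).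
have PB : sin B `^ e <= sin (A + B) `^ e.
  by rewrite ge0_ler_powR ?nnegrE ?(ltW e0) ?(ltW sB0) ?(ltW S0).
rewrite ger0_norm; last first.
  have -> : (A + B) * sin (A + B) `^ e - A * sin A `^ e - B * sin B `^ e =
    A * (sin (A + B) `^ e - sin A `^ e) + B * (sin (A + B) `^ e - sin B `^ e) by ring.
  by rewrite addr_ge0 // mulr_ge0 ?subr_ge0 // ltW.
have GA := powRB_le_ln _ e _ _ sA0 S0.
have GB := powRB_le_ln _ e _ _ sB0 S0.
have L := sin_ln_obtuse _ _ _ A0 B0 AB.
set S := sin (A + B) in S0 SA SB PA PB GA GB L *.
have SAB : S <= sin A + sin B.
  rewrite /S sinD; have := cos_le1 A; have := cos_le1 B; nra.
apply: (@le_trans _ _ (e * S `^ e * (A * ln (S / sin A) + B * ln (S / sin B)))).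
  have := ler_wpM2l (ltW A0) GA; have := ler_wpM2l (ltW B0) GB; nra.
apply: (@le_trans _ _ (e * S `^ e * (ln 2 * (sin A + sin B)))).
  by rewrite ler_wpM2l // mulr_ge0 ?powR_ge0 ?ltW.
have -> : e * S `^ e * (ln 2 * (sin A + sin B)) =
  e * ln 2 * ((sin A + sin B) * S `^ e) by ring.
rewrite -!mulrA ler_pM2l // ler_pM2l //.
(* Since S <= sin A + sin B, the factor S^e is absorbed into the power 1 + e of the sum, which
   [powRD_le] splits at the cost of 2^e. *)
apply: (@le_trans _ _ ((sin A + sin B) `^ (1 + e))).
  rewrite powRD; last by rewrite gt_eqF ?implybT // addr_gt0.
  rewrite powRr1 ?(ltW (addr_gt0 sA0 sB0)) // ler_pM2l ?addr_gt0 //.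
  by rewrite ge0_ler_powR ?nnegrE ?(ltW e0) ?(ltW S0) ?(ltW (addr_gt0 sA0 sB0)).
have := @powRD_le R (1 + e) (sin A) (sin B).
by rewrite lerDl (_ : 1 + e - 1 = e); [apply; rewrite ltW | ring].
Qed.

Lemma cosDsin_ge1 (R : realType) (A : R) : 0 <= A <= pi / 2 -> 1 <= sin A + cos A.
Proof.
move=> A0; have pi0 := pi_gt0 R.
have s0 : 0 <= sin A by apply: sin_ge0_pi; lra.
have c0 : 0 <= cos A by apply: cos_ge0_pihalf; lra.
have := cos2Dsin2 A; have := cos_le1 A; have := sin_le1 A; nra.
Qed.

(* The three bounds of the proof add up because of the identity
   (1 + sin G) (sin A + sin B - cos A - cos B) =
     cos G (sin A + sin B + cos A + cos B)   for A + B + G = pi. *)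
Lemma sin_ln_acute (R : realType) (A B G : R) :
  0 < A <= pi / 2 -> 0 < B <= pi / 2 -> 0 < G <= pi / 2 -> A + B + G = pi ->
  A * - ln (sin A) + B * - ln (sin B) + G * - ln (sin G) <=
  ln 2 * (sin A + sin B).
Proof.
move=> hA hB hG ABG; have pi0 := pi_gt0 R.
have pos (x : R) : 0 < x <= pi / 2 -> 0 < sin x /\ 0 <= cos x.
  by move=> hx; split; [apply: sin_gt0_pi|apply: cos_ge0_pihalf]; lra.
have lnle (x : R) : 0 < x <= pi / 2 -> - ln (sin x) <= (1 - sin x) / sin x.
  move=> hx; have [sx _] := pos _ hx.
  have := @ln_leB1 R (sin x)^-1; rewrite invr_gt0 => /(_ sx).
  by rewrite lnV ?posrE // mulrBl mul1r divff ?gt_eqF.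
(* For A and B the weight is split as x = sin x + (x - sin x), and this bounds the remainder; the
   sine parts are left to [J] and [JS]. The third angle G is treated whole in [KG]. *)
have K (x : R) : 0 < x <= pi / 2 ->
    (x - sin x) * - ln (sin x) <= (sin x + cos x - 1) / 2.
  move=> hx; have [sx cx] := pos _ hx.
  have s1 := sin_le1 x; have c1 := cos_le1 x; have cs := cos2Dsin2 x.
  have xs : sin x <= x by apply: sin_le_id; lra.
  have xc : x * cos x <= sin x by apply: mul_cos_le_sin; lra.
  have sc : 1 <= sin x + cos x by apply: cosDsin_ge1; lra.
  apply: (le_trans (ler_wpM2l _ (lnle _ hx))); first by rewrite subr_ge0.
  apply: (@le_trans _ _ (cos x * (1 - cos x) / (1 + sin x))).
    rewrite mulrA ler_pdivrMr // mulrAC ler_pdivlMr; last lra.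
    have -> : (x - sin x) * (1 - sin x) * (1 + sin x) =
      cos x * (x * cos x - sin x * cos x).
      have -> : (x - sin x) * (1 - sin x) * (1 + sin x) =
        (x - sin x) * (1 - sin x ^+ 2) by ring.
      by rewrite -cs addrK; ring.
    have -> : cos x * (1 - cos x) * sin x = cos x * (sin x - sin x * cos x) by ring.
    by rewrite ler_wpM2l // lerB.
  rewrite ler_pdivrMr; last lra.
  have -> : (sin x + cos x - 1) / 2 * (1 + sin x) =
    cos x * (1 - cos x) / 2 + cos x * sin x / 2.
    have -> : (sin x + cos x - 1) / 2 * (1 + sin x) =
      (sin x ^+ 2 - 1 + cos x + cos x * sin x) / 2 by field.
    by rewrite -[X in _ - X]cs; field.
  have : cos x * (1 - cos x) <= cos x * sin x by rewrite ler_wpM2l // lerBlDr.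
  lra.
have [sA cA] := pos _ hA; have [sB cB] := pos _ hB; have [sG cG] := pos _ hG.
have EG : G = pi - (A + B) by lra.
have EsG : sin G = sin A * cos B + cos A * sin B.
  by rewrite EG sinB sinpi cospi sinD; ring.
have EcG : cos G = sin A * sin B - cos A * cos B.
  by rewrite EG cosB sinpi cospi cosD; ring.
have scA : 1 <= sin A + cos A by apply: cosDsin_ge1; lra.
have scB : 1 <= sin B + cos B by apply: cosDsin_ge1; lra.
have id : (1 + sin G) * (sin A + sin B - cos A - cos B) =
   cos G * (sin A + sin B + cos A + cos B).
  rewrite EsG EcG; have := cos2Dsin2 A; have := cos2Dsin2 B.
  move=> HB HA.
  have HA' : sin A ^+ 2 = 1 - cos A ^+ 2 by rewrite -HA; ring.
  have HB' : sin B ^+ 2 = 1 - cos B ^+ 2 by rewrite -HB; ring.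
  by ring: HA' HB'.
(* Once G cos G <= sin G has been used, what remains is 2 cos G <= (1 + sin G) (sin A + sin B - cos
   A - cos B), which [id] reduces to sin + cos >= 1 at A and at B. *)
have KG : G * - ln (sin G) <= (sin A + sin B - cos A - cos B) / 2.
  have xc : G * cos G <= sin G by apply: mul_cos_le_sin; lra.
  have G0 : 0 <= G by lra.
  apply: (le_trans (ler_wpM2l G0 (lnle _ hG))).
  apply: (@le_trans _ _ (cos G / (1 + sin G))).
    rewrite mulrA ler_pdivrMr // mulrAC ler_pdivlMr; last lra.
    have -> : G * (1 - sin G) * (1 + sin G) = cos G * (G * cos G).
      have -> : G * (1 - sin G) * (1 + sin G) = G * (1 - sin G ^+ 2) by ring.
      by rewrite -(cos2Dsin2 G) addrK; ring.
    by rewrite ler_wpM2l.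
  rewrite ler_pdivrMr; last lra.
  have -> : (sin A + sin B - cos A - cos B) / 2 * (1 + sin G) =
     (1 + sin G) * (sin A + sin B - cos A - cos B) / 2 by ring.
  rewrite id; have : cos G * 2 <= cos G * (sin A + sin B + cos A + cos B).
    by rewrite ler_wpM2l //; lra.
  lra.
have sig0 : 0 < sin A + sin B by rewrite addr_gt0.
have J := xlnx_pair_le _ _ _ sA sB.
have JS : (sin A + sin B) * - ln (sin A + sin B) <= 1 - (sin A + sin B).
  have := @ln_leB1 R (sin A + sin B)^-1; rewrite invr_gt0 => /(_ sig0).
  rewrite lnV ?posrE // => H.
  apply: (le_trans (ler_wpM2l (ltW sig0) H)).
  by rewrite mulrBr mulr1 divff ?gt_eqF.
have := K _ hA; have := K _ hB; lra.
Qed.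

(** No angle exceeds pi/2, and 1 takes the place of the sine of the sum: [powRB_le_ln] with b = 1
    gives 1 - s^e <= - e ln s, and [sin_ln_acute] bounds the total. *)
Lemma sin_powR_acute (R : realType) (e A B G : R) : 0 < e ->
  0 <= A <= pi / 2 -> 0 <= B <= pi / 2 -> 0 <= G <= pi / 2 -> A + B + G = pi ->
  `|A * (1 - sin A `^ e) + B * (1 - sin B `^ e) + G * (1 - sin G `^ e)| <=
  e * ln 2 * 2 `^ e * (sin A `^ (1 + e) + sin B `^ (1 + e)).
Proof.
move=> e0 hA hB hG ABG; have pi0 := pi_gt0 R.
have ln20 : 0 < ln (2 : R) by rewrite ln_gt0 // ltr1n.
have rhs0 (x y : R) : 0 <= e * ln 2 * 2 `^ e * (x `^ (1 + e) + y `^ (1 + e)).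
  by rewrite !mulr_ge0 ?addr_ge0 ?powR_ge0 ?ltW.
have p1 : (1 : R) `^ e = 1 by rewrite powR1.
(* A zero angle forces the other two to be pi/2, and then the left-hand side vanishes. *)
have [A0|A0] := eqVneq A 0.
  have [-> ->] : B = pi / 2 /\ G = pi / 2 by lra.
  by rewrite A0 mul0r !sin_pihalf p1 subrr !mulr0 !addr0 normr0 rhs0.
have [B0|B0] := eqVneq B 0.
  have [-> ->] : A = pi / 2 /\ G = pi / 2 by lra.
  by rewrite B0 mul0r !sin_pihalf p1 subrr !mulr0 !addr0 normr0 rhs0.
have [G0|G0] := eqVneq G 0.
  have [-> ->] : A = pi / 2 /\ B = pi / 2 by lra.
  by rewrite G0 mul0r !sin_pihalf p1 subrr !mulr0 !addr0 normr0 rhs0.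
have pA : 0 < A <= pi / 2 by rewrite lt_def A0.
have pB : 0 < B <= pi / 2 by rewrite lt_def B0.
have pG : 0 < G <= pi / 2 by rewrite lt_def G0.
have T (x : R) : 0 < x <= pi / 2 ->
    0 <= x * (1 - sin x `^ e) <= e * (x * - ln (sin x)).
  move=> hx; have sx : 0 < sin x by apply: sin_gt0_pi; lra.
  have x0 : 0 <= x by lra.
  apply/andP; split.
    rewrite mulr_ge0 // subr_ge0 -p1 ge0_ler_powR ?nnegrE ?sin_le1 //.
      by rewrite ltW.
    by rewrite ltW.
  have := powRB_le_ln _ e _ _ sx ltr01; rewrite p1 mul1r ln_div ?posrE // ln1 sub0r => H.
  by rewrite mulrCA ler_wpM2l.
have /andP[TA0 TA] := T _ pA; have /andP[TB0 TB] := T _ pB.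
have /andP[TG0 TG] := T _ pG.
have L := sin_ln_acute _ _ _ _ pA pB pG ABG.
rewrite ger0_norm ?addr_ge0 //.
apply: (@le_trans _ _ (e * (ln 2 * (sin A + sin B)))).
  have := ler_wpM2l (ltW e0) L; lra.
rewrite -!mulrA ler_pM2l // ler_pM2l //.
have sA : 0 < sin A by apply: sin_gt0_pi; lra.
have sB : 0 < sin B by apply: sin_gt0_pi; lra.
apply: (@le_trans _ _ ((sin A + sin B) `^ (1 + e))).
  rewrite le1r_powR //; last by rewrite lerDl ltW.
  (* The angle G is at most pi / 2, so B is at least pi / 2 - A. *)
  have := cosDsin_ge1 R A; rewrite ltW; last lra.
  have : cos A <= sin B.
    have -> : cos A = sin (- A + pi / 2) by rewrite sinDpihalf cosN.
    have : - A + pi / 2 <= B by lra.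
    by rewrite le_eqVlt => /predU1P[->//|h]; rewrite ltW // ltr_sin ?in_itv /=; lra.
  by move=> H /(_ _); lra.
have := @powRD_le R (1 + e) (sin A) (sin B).
rewrite lerDl (_ : 1 + e - 1 = e); last by ring.
by apply; rewrite ltW.
Qed.

(** * The cocycle estimate *)

Definition chord (R : realType) (x : R) : R := `|2 * sin (x / 2)|.

(** Subtracts the nearest multiple of 2 pi; the representative lies in [-pi, pi). *)
Definition angle_rep (R : realType) (x : R) : R :=
  x - 2 * pi * (Num.floor (x / (2 * pi) + 2^-1))%:~R.

(** The gap between 2^e x and f on [-pi, pi]. It vanishes at both ends, where the chord is 2, so it
    extends continuously with period 2 pi. *)
Definition defect (R : realType) (e x : R) : R := x * (2 `^ e - chord R x `^ e).

Lemma chordN (R : realType) (x : R) : chord R (- x) = chord R x.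
Proof. by rewrite /chord mulNr sinN mulrN normrN. Qed.

Lemma chord_ge0 (R : realType) (x : R) : 0 <= chord R x.
Proof. exact: normr_ge0. Qed.

Lemma chord_le2 (R : realType) (x : R) : chord R x <= 2.
Proof. by rewrite /chord normrM ger0_norm // ler_piMr // sin_max. Qed.

Lemma chordDpi (R : realType) (x : R) : chord R (x + 2 * pi) = chord R x.
Proof.
rewrite /chord [(x + _) / _]mulrDl.
have -> : 2 * pi / 2 = pi :> R by field.
by rewrite sinDpi mulrN normrN.
Qed.

Lemma periodic_int (R : realType) (V : Type) (f : R -> V) (T : R) :
  (forall x, f (x + T) = f x) -> forall x (k : int), f (x + T * k%:~R) = f x.
Proof.
move=> fT; have P n x : f (x + T * n%:R) = f x.
  elim: n => [|n IH]; first by rewrite mulr0 addr0.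
  by rewrite -IH -[RHS]fT; congr f; rewrite -addn1 natrD; ring.
move=> x [n|n]; first exact: P.
by rewrite NegzE mulrNz mulrN -[in RHS](subrK (T * n.+1%:R) x) P.
Qed.

Lemma chordDpi_int (R : realType) (x : R) (m : int) :
  chord R (x + 2 * pi * m%:~R) = chord R x.
Proof. by apply: periodic_int; exact: chordDpi. Qed.

Lemma defectN (R : realType) (e x : R) : defect R e (- x) = - defect R e x.
Proof. by rewrite /defect chordN mulNr. Qed.

Lemma angle_rep_bound (R : realType) (x : R) : `|angle_rep R x| <= pi.
Proof.
have p0 : 0 < 2 * pi :> R by rewrite mulr_gt0 // pi_gt0.
rewrite /angle_rep; set k := Num.floor _.
have /andP[k1 k2] : (k%:~R : R) <= x / (2 * pi) + 2^-1 < k%:~R + 1.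
  by rewrite /k ge_floor -intrD1 lt_succ_floor.
have E : x = x / (2 * pi) * (2 * pi) by rewrite divfK // gt_eqF.
rewrite ler_norml [X in _ <= X - _ <= _]E.
set y := x / (2 * pi) in k1 k2 *; apply/andP; split; nra.
Qed.

Lemma chord_angle_rep (R : realType) (x : R) : chord R (angle_rep R x) = chord R x.
Proof. by rewrite /angle_rep -mulrN -mulrNz chordDpi_int. Qed.

Lemma angle_rep_id (R : realType) (x : R) : `|x| < pi -> angle_rep R x = x.
Proof.
rewrite ltr_norml => /andP[x1 x2]; have p0 : 0 < pi := pi_gt0 R.
rewrite /angle_rep (_ : Num.floor _ = 0) ?mulr0 ?subr0 //.
have E : x = x / (2 * pi) * (2 * pi) by rewrite divfK // gt_eqF // mulr_gt0.
rewrite E in x1 x2; apply: floor_def.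
set y := x / (2 * pi) in x1 x2 *; rewrite add0r /=.
apply/andP; split; nra.
Qed.

Lemma defect_half (R : realType) (e x : R) : 0 <= x <= pi ->
  defect R e x = 2 * 2 `^ e * (x / 2 * (1 - sin (x / 2) `^ e)).
Proof.
move=> hx; have p0 := pi_gt0 R.
have s0 : 0 <= sin (x / 2) by apply: sin_ge0_pi; lra.
by rewrite /defect /chord ger0_norm ?mulr_ge0 // powRM //; field.
Qed.

Lemma chord_half (R : realType) (e x : R) : 0 <= x <= pi ->
  chord R x `^ (1 + e) = 2 * 2 `^ e * sin (x / 2) `^ (1 + e).
Proof.
move=> hx; have p0 := pi_gt0 R.
have s0 : 0 <= sin (x / 2) by apply: sin_ge0_pi; lra.
rewrite /chord ger0_norm ?mulr_ge0 // powRM //; congr (_ * _).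
by rewrite powRD ?powRr1 // pnatr_eq0 implybT.
Qed.

Lemma chord_le (R : realType) (x y : R) : 0 <= x -> x <= y -> y <= pi ->
  chord R x <= chord R y.
Proof.
move=> x0 xy ypi; have p0 := pi_gt0 R.
have sx : 0 <= sin (x / 2) by apply: sin_ge0_pi; lra.
have sy : 0 <= sin (y / 2) by apply: sin_ge0_pi; lra.
rewrite /chord !ger0_norm ?mulr_ge0 // ler_pM2l //.
move: xy; rewrite le_eqVlt => /predU1P[->//|xy].
by rewrite ltW // ltr_sin ?in_itv /=; lra.
Qed.

(** If the sum is 2 pi or -2 pi, the three angles have the same sign and cut the whole circle: acute
    case. If it is 0, the longest arc is the sum of the other two: obtuse case. *)
Lemma defect_cocycle_reduced (R : realType) (e x y z : R) (m : int) : 0 < e ->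
  `|x| <= pi -> `|y| <= pi -> `|z| <= pi -> x + y + z = 2 * pi * m%:~R ->
  `|defect R e x + defect R e y + defect R e z| <=
  e * ln 2 * 2 `^ e * (chord R x `^ (1 + e) + chord R y `^ (1 + e)).
Proof.
move=> e0; have p0 := pi_gt0 R.
have ln20 : 0 < ln (2 : R) by rewrite ln_gt0 // ltr1n.
have k0 : 0 <= e * ln 2 * 2 `^ e by rewrite !mulr_ge0 ?powR_ge0 ?ltW.
have obt (u v : R) : 0 <= u -> 0 <= v -> u + v <= pi ->
    `|defect R e u + defect R e v - defect R e (u + v)| <=
    e * ln 2 * 2 `^ e * (chord R u `^ (1 + e) + chord R v `^ (1 + e)).
  move=> u0 v0 uv; rewrite !defect_half ?chord_half; [|lra..].
  have := @sin_powR_obtuse R e (u / 2) (v / 2) e0.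
  rewrite -mulrDl => /(_ _ _ _)/wrap[]; [lra..|move=> H].
  set Q := 2 * 2 `^ e; rewrite (_ : _ - _ = Q * ((u + v) / 2 * sin ((u + v) / 2) `^ e -
     u / 2 * sin (u / 2) `^ e - v / 2 * sin (v / 2) `^ e)); last by field.
  rewrite normrM ger0_norm ?mulr_ge0 ?powR_ge0 // -mulrDr mulrCA.
  by rewrite ler_wpM2l // mulr_ge0 ?powR_ge0.
have acu (u v w : R) : 0 <= u <= pi -> 0 <= v <= pi -> 0 <= w <= pi -> u + v + w = 2 * pi ->
    `|defect R e u + defect R e v + defect R e w| <=
    e * ln 2 * 2 `^ e * (chord R u `^ (1 + e) + chord R v `^ (1 + e)).
  move=> hu hv hw uvw; rewrite !defect_half ?chord_half //.
  have := @sin_powR_acute R e (u / 2) (v / 2) (w / 2) e0.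
  rewrite -!mulrDl => /(_ _ _ _ _)/wrap[]; [lra..|move=> H].
  rewrite -!mulrDr normrM ger0_norm ?mulr_ge0 ?powR_ge0 // mulrCA.
  by rewrite ler_wpM2l // mulr_ge0 ?powR_ge0.
have mono (u v : R) : 0 <= u -> u <= v -> v <= pi ->
    chord R u `^ (1 + e) <= chord R v `^ (1 + e).
  by move=> *; rewrite ge0_ler_powR ?nnegrE ?chord_ge0 ?chord_le // addr_ge0 // ltW.
(* For opposite signs, the longer of u and v is made up of the other two arcs. Applying [obt] to
   these puts the chord of u + v on the right, and monotonicity replaces it by the longer chord. *)
have mixed (u v : R) : 0 <= u -> v <= 0 -> u <= pi -> - pi <= v ->
    `|defect R e u + defect R e v - defect R e (u + v)| <=
    e * ln 2 * 2 `^ e * (chord R u `^ (1 + e) + chord R v `^ (1 + e)).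
  move=> u0 v0 u1 v1; have [s0|s0] := lerP 0 (u + v).
    have := obt (- v) (u + v); rewrite addrCA addNr addr0 => /(_ _ _ _)/wrap[]; [lra..|].
    rewrite defectN chordN => H.
    rewrite -normrN; have -> : - (defect R e u + defect R e v - defect R e (u + v)) =
      - defect R e v + defect R e (u + v) - defect R e u by ring.
    apply: (le_trans H); rewrite ler_wpM2l // addrC lerD2r mono //; lra.
  have := obt u (- (u + v)); rewrite opprD addNKr => /(_ _ _ _)/wrap[]; [lra..|].
  rewrite -opprD !defectN -(chordN _ v) opprK => H.
  have -> : defect R e u + defect R e v - defect R e (u + v) =
    defect R e u - defect R e (u + v) + defect R e v by ring.
  apply: (le_trans H); rewrite ler_wpM2l // lerD2l mono //; lra.
rewrite !(ler_norml _ pi) => /andP[x1 x2] /andP[y1 y2] /andP[z1 z2] S.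
(* The sum is at most 3 pi in modulus, so |m| < 2. *)
have [m1|m1|m0] : [\/ m = 1, m = -1 | m = 0].
  have : (m%:~R : R) < 2%:~R by rewrite /=; nra.
  have : ((- 2)%:~R : R) < m%:~R by rewrite /=; nra.
  rewrite !ltr_int; case: m {S} => [[|[|[|n]]]|[|[|n]]] //= _ _;
  by [constructor 1|constructor 2|constructor 3].
- by apply: acu; rewrite m1 mulr1 in S; lra.
- have := acu (- x) (- y) (- z); rewrite !defectN !chordN -!opprD normrN.
  by apply; rewrite m1 mulrN1z mulrN1 in S; lra.
have -> : z = - (x + y) by rewrite m0 mulr0 in S; lra.
rewrite m0 mulr0 in S; rewrite defectN.
have [x0|x0] := lerP 0 x; have [y0|y0] := lerP 0 y.
- by apply: obt; lra.
- by apply: mixed; lra.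
- by rewrite [x + y]addrC [_ `^ _ + _]addrC (addrC (defect R e x)); apply: mixed; lra.
- have := obt (- x) (- y); rewrite -opprD !defectN !chordN => H.
  rewrite -normrN.
  have -> : - (defect R e x + defect R e y - defect R e (x + y)) =
    - defect R e x - defect R e y - - defect R e (x + y) by ring.
  by apply: H; lra.
Qed.

(* The function [f] of the header; see [angle_rep_id] for its values on (-pi, pi). *)
Definition dist_angle (R : realType) (e x : R) : R :=
  2 `^ e * x - defect R e (angle_rep R x).

(** The linear part of f is additive, so its deviation from additivity is that of [defect], taken at
    the reduced angles of x and y and at the opposite of that of x + y. *)
Lemma dist_angle_cocycle (R : realType) (e x y : R) : 0 < e ->
  `|dist_angle R e (x + y)| <= `|dist_angle R e x| + `|dist_angle R e y| +
  e * ln 2 * 2 `^ e * (chord R x `^ (1 + e) + chord R y `^ (1 + e)).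
Proof.
move=> e0.
pose k (t : R) := Num.floor (t / (2 * pi) + 2^-1).
have := @defect_cocycle_reduced R e (angle_rep R x) (angle_rep R y)
  (- angle_rep R (x + y)) (k (x + y) - k x - k y) e0.
rewrite normrN !angle_rep_bound !chord_angle_rep defectN => /(_ isT isT isT _)/wrap[].
  by rewrite /angle_rep /k !intrB; ring.
move=> H; rewrite -addrA -lerBlDl.
rewrite /dist_angle.
set dx := defect R e _ in H *; set dy := defect R e _ in H *.
set dxy := defect R e _ in H *.
have -> : 2 `^ e * (x + y) - dxy = (2 `^ e * x - dx) + (2 `^ e * y - dy) +
   (dx + dy - dxy) by ring.
have := ler_normD (2 `^ e * x - dx + (2 `^ e * y - dy)) (dx + dy - dxy).
have := ler_normD (2 `^ e * x - dx) (2 `^ e * y - dy).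
lra.
Qed.

Lemma chord_norm (R : realType) (x : R) : chord R `|x| = chord R x.
Proof.
by have [h|h] := ger0P x; rewrite ?chordN.
Qed.

Lemma angle_rep_E (R : realType) (x : R) :
  exists k : int, x = angle_rep R x + 2 * pi * k%:~R.
Proof. by exists (Num.floor (x / (2 * pi) + 2^-1)); rewrite /angle_rep subrK. Qed.

Lemma dist_angle_lower (R : realType) (e x : R) : 0 < e ->
  2 `^ e * `|x| - 2 `^ e * pi <= `|dist_angle R e x|.
Proof.
move=> e0; apply: (@le_trans _ _ (`|2 `^ e * x| - `|defect R e (angle_rep R x)|)).
  2: exact: lerB_dist.
rewrite normrM (ger0_norm (powR_ge0 _ _)) lerB // /defect normrM mulrC.
rewrite ler_pM ?angle_rep_bound //.
have c1 := powR_ge0 (chord R (angle_rep R x)) e.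
have c2 : chord R (angle_rep R x) `^ e <= 2 `^ e.
  by rewrite ge0_ler_powR ?nnegrE ?chord_ge0 ?chord_le2 // ltW.
by rewrite ger0_norm ?subr_ge0 //; lra.
Qed.

(** On this range f x is x times the chord to the power e, and |x| is at most twice the chord
    because cos (x/2) >= 7/8. The constant 2 only multiplies a term that disappears in the limit. *)
Lemma dist_angle_small (R : realType) (e x : R) : 0 < e -> `|x| < 1 ->
  `|dist_angle R e x| <= 2 * chord R x `^ (1 + e).
Proof.
move=> e0 x1; have pi2 := pi_ge2 R.
rewrite /dist_angle angle_rep_id; last by lra.
have -> : 2 `^ e * x - defect R e x = x * chord R x `^ e by rewrite /defect; ring.
rewrite normrM [X in _ * X]ger0_norm ?powR_ge0 //.
rewrite powRD; last by apply/implyP => /eqP; lra.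
rewrite powRr1 ?chord_ge0 // mulrA ler_wpM2r ?powR_ge0 //.
rewrite -(chord_norm _ x) -normr_id.
move: (`|x|) (normr_ge0 x) x1 => {}x x0 x1; rewrite ger0_norm //.
have s0 : 0 <= sin (x / 2) by apply: sin_ge0_pi; lra.
rewrite /chord ger0_norm ?mulr_ge0 //.
have := @mul_cos_le_sin R (x / 2).
have -> : cos (x / 2) = 1 - 2 * sin (x / 4) ^+ 2.
  have -> : x / 2 = (x / 4) *+ 2 by rewrite mulr2n; field.
  by rewrite cos_mulr2n cos2sin2; ring.
have := sqr_sin_le R (x / 4).
have : (x / 4) ^+ 2 <= 1 / 16 by nra.
move=> h1 h2 /(_ _)/wrap[]; first by lra.
nra.
Qed.

Lemma normc_expiB (R : realType) (a b : R) :
  Normc.normc (val (expi a) - val (expi b)) = chord R (a - b).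
Proof.
rewrite /= /chord -sqrtr_sqr; congr Num.sqrt.
set h := (a - b) / 2; have -> : a = b + (h + h) by rewrite /h; field.
rewrite !(cosD, sinD).
have Hb := cos2Dsin2 b; have Hh := cos2Dsin2 h.
have Eb : sin b ^+ 2 = 1 - cos b ^+ 2 by rewrite -Hb; ring.
have Eh : cos h ^+ 2 = 1 - sin h ^+ 2 by rewrite -Hh; ring.
by ring: Eb Eh.
Qed.

Lemma chord_gt0 (R : realType) (x : R) : 0 < `|x| <= pi -> 0 < chord R x.
Proof.
move=> hx; rewrite -chord_norm.
move: (`|x|) hx => {}x hx; have p0 := pi_gt0 R.
by rewrite /chord normrM mulr_gt0 // ger0_norm ?sin_ge0_pi ?sin_gt0_pi //; lra.
Qed.

(** * Continuous liftings: quasi-periodicity, linear growth, uniform continuity *)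

Section lifting.
Context (R : realType) (phi : R -> R) (d : int).
Hypothesis cphi : continuous phi.

(** [psi] is continuous, vanishes at 0, and only takes values of chord 0. A nonzero value would
    force an intermediate one of modulus in ]0, pi], where the chord is positive. *)
Lemma lift_quasi_periodic : (forall t, expi (phi (t + 2 * pi)) = expi (phi t)) ->
  phi (2 * pi) - phi 0 = 2 * pi * d%:~R ->
  forall t, phi (t + 2 * pi) = phi t + 2 * pi * d%:~R.
Proof.
move=> ex deg t; have p0 := pi_gt0 R.
pose psi s := phi (s + 2 * pi) - phi s - 2 * pi * d%:~R.
suff : psi t = 0 by rewrite /psi; lra.
have cpsi : continuous psi.
  move=> s; apply: cvgB; last exact: cvg_cst.
  apply: cvgB; last exact: cphi.
  apply: (@continuous_comp _ _ _ (fun s => s + 2 * pi) phi); last exact: cphi.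
  by apply: cvgD; [exact: cvg_id|exact: cvg_cst].
have psi0 : psi 0 = 0 by rewrite /psi add0r deg subrr.
have chpsi s : chord R (psi s) = 0.
  rewrite /psi -mulrN -mulrNz chordDpi_int -normc_expiB ex subrr.
  by rewrite /= expr0n /= addr0 sqrtr0.
apply/eqP; apply: contraT => pt.
(* The witness is [psi t] truncated to [-pi, pi]. *)
have [v av hv] : exists2 v, 0 < `|v| <= pi &
    Num.min 0 (psi t) <= v <= Num.max 0 (psi t).
  case: (ltrgt0P (psi t)) pt => // h _.
    have m0 : 0 < Num.min (psi t) pi by rewrite lt_min h.
    exists (Num.min (psi t) pi); first by rewrite gtr0_norm // m0 ge_min lexx orbT.
    by rewrite (ltW m0) ge_min lexx.
  have m0 : 0 < Num.min (- psi t) pi by rewrite lt_min oppr_gt0 h.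
  exists (- Num.min (- psi t) pi); first by rewrite normrN gtr0_norm // m0 ge_min lexx orbT.
  by rewrite oppr_le0 (ltW m0) lerNr ge_min lexx.
have wc (A : set R) : {within A, continuous psi} by apply: continuous_subspaceT.
have [c fc] : exists c, psi c = v.
  case: (lerP 0 t) => ht.
    have := @IVT R psi 0 t v ht (wc _).
    by rewrite psi0 => /(_ hv) [c _ <-]; exists c.
  have := @IVT R psi t 0 v (ltW ht) (wc _).
  by rewrite psi0 minC maxC => /(_ hv) [c _ <-]; exists c.
by have := chord_gt0 _ _ av; rewrite -fc chpsi ltxx.
Qed.

Hypothesis qphi : forall t, phi (t + 2 * pi) = phi t + 2 * pi * d%:~R.

Let per (x : R) := phi x - d%:~R * x.

Let per_int x (k : int) : per (x + 2 * pi * k%:~R) = per x.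
Proof. by apply: periodic_int => y; rewrite /per qphi; ring. Qed.

Let cper : continuous per.
Proof.
move=> x; apply: cvgB; first exact: cphi.
by apply: cvgM; [exact: cvg_cst|exact: cvg_id].
Qed.

(** Removing the linear part leaves the continuous periodic function [per], which is bounded by the
    maximum of its modulus on [-pi, pi]. *)
Lemma lift_growth :
  exists M : R, forall a b, `|phi b - phi a - d%:~R * (b - a)| <= M.
Proof.
have pp : - pi <= (pi : R) by have := pi_gt0 R; lra.
have [c _ cmax] := EVT_max pp (continuous_subspaceT (fun x => cvg_norm (@cper x))).
have B x : `|per x| <= `|per c|.
  have [k ->] := angle_rep_E R x; rewrite per_int; apply: cmax.
  by rewrite in_itv /= -ler_norml angle_rep_bound.
exists (2 * `|per c|) => a b.
have -> : phi b - phi a - d%:~R * (b - a) = per b - per a by rewrite /per; ring.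
by apply: (le_trans (ler_normB _ _)); have := B a; have := B b; lra.
Qed.

(** Compactness of [-pi, pi] gives one [del] for all base points there, the other point being free
    on the line. Translation by multiples of 2 pi, which preserves the increments of [phi], reaches
    every base point. *)
Lemma lift_unif_continuous :
  exists2 del : R, 0 < del & forall a b, `|b - a| < del -> `|phi b - phi a| < 1.
Proof.
have /compact_near_coveringP cov := @segment_compact R (- pi) pi.
have : \forall del \near 0^'+, `[(- pi : R), pi]%classic `<=`
    (fun x => forall y, `|y - x| < del -> `|phi y - phi x| < 1).
  apply: cov => x _.
  have /cvgrPdist_lt/(_ 2^-1) := cphi x; rewrite invr_gt0 => /(_ (ltr0Sn _ _)).
  move=> /nbhs_ballP[r /= r0 hr].
  have hr' y : `|y - x| < r -> `|phi y - phi x| < 2^-1.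
    by move=> h; rewrite distrC; apply: hr; rewrite /ball /= distrC.
  have r2 : 0 < r / 2 by rewrite divr_gt0.
  exists (ball x (r / 2), [set del : R | del < r / 2]).
    split; first exact: nbhsx_ballx.
    exact: nbhs_right_lt.
  case=> x' del [/= bx' hdel] y hy.
  have hx' : `|x' - x| < r / 2 by rewrite distrC.
  have h1 : `|phi x' - phi x| < 2^-1 by apply: hr'; lra.
  have h2 : `|phi y - phi x| < 2^-1.
    apply: hr'; have := ler_normD (y - x') (x' - x); rewrite addrA subrK; lra.
  have := ler_normB (phi y - phi x) (phi x' - phi x).
  by rewrite opprB addrA subrK; lra.
move=> hn.
have [del [hdel del0]] : exists del : R, (`[(- pi : R), pi]%classic `<=`
    (fun x => forall y, `|y - x| < del -> `|phi y - phi x| < 1)) /\ 0 < del.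
  near (0 : R)^'+ => del; exists del; split; near: del; first exact: hn.
  exact: nbhs_right_gt.
exists del => // a b ab.
have [k ak] := angle_rep_E R a.
have E y : phi y = phi (y - 2 * pi * k%:~R) + d%:~R * (2 * pi * k%:~R).
  have := per_int (y - 2 * pi * k%:~R) k; rewrite subrK /per; lra.
rewrite (E a) (E b) opprD addrACA subrr addr0.
have -> : a - 2 * pi * k%:~R = angle_rep R a by rewrite {1}ak addrK.
apply: hdel; first by rewrite /= in_itv /= -ler_norml angle_rep_bound.
by rewrite -[angle_rep R a](addrK (2 * pi * k%:~R)) -ak opprB addrA subrK.
Unshelve. all: by end_near.
Qed.

End lifting.

(** * Integrals of nonnegative functions *)

Section tonelli_sets.
Context d1 d2 (T1 : measurableType d1) (T2 : measurableType d2) (R : realType).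
Variables (m1 : {sigma_finite_measure set T1 -> \bar R})
  (m2 : {sigma_finite_measure set T2 -> \bar R}).
Variables (A : set T1) (B : set T2) (f : T1 * T2 -> \bar R).
Hypotheses (mA : measurable A) (mB : measurable B).
Hypotheses (mf : measurable_fun setT f) (f0 : forall z, (0 <= f z)%E).

Let h := f \_ (A `*` B).

Let mh : measurable_fun setT h.
Proof.
by apply/(measurable_restrictT _ (measurableX mA mB)); exact: measurable_funTS.
Qed.

Let h0 z : (0 <= h z)%E.
Proof. by apply: erestrict_ge0 => *; exact: f0. Qed.

Let hE1 x : (\int[m2]_y h (x, y) = ((fun x => \int[m2]_(y in B) f (x, y)) \_ A) x)%E.
Proof.
rewrite patchE; case: ifPn => xA.
  rewrite [RHS]integral_mkcond; apply: eq_integral => y _.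
  rewrite /h !patchE; congr (if _ then _ else _).
  by apply/idP/idP => [/set_mem[_ ?]|/set_mem ?]; apply/mem_set => //; split=> //; exact: set_mem.
rewrite integral0_eq // => y _; rewrite /h patchE ifF //.
by apply/negbTE; apply: contra xA; rewrite !inE => -[].
Qed.

Let hE2 y : (\int[m1]_x h (x, y) = ((fun y => \int[m1]_(x in A) f (x, y)) \_ B) y)%E.
Proof.
rewrite patchE; case: ifPn => yB.
  rewrite [RHS]integral_mkcond; apply: eq_integral => x _.
  rewrite /h !patchE; congr (if _ then _ else _).
  by apply/idP/idP => [/set_mem[? _]|/set_mem ?]; apply/mem_set => //; split=> //; exact: set_mem.
rewrite integral0_eq // => x _; rewrite /h patchE ifF //.
by apply/negbTE; apply: contra yB; rewrite !inE => -[].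
Qed.

(** Extending [f] by 0 outside the rectangle reduces this to the whole product space. *)
Lemma tonelli_set :
  (\int[m1]_(x in A) \int[m2]_(y in B) f (x, y) =
   \int[m2]_(y in B) \int[m1]_(x in A) f (x, y))%E.
Proof.
rewrite [LHS]integral_mkcond [RHS]integral_mkcond.
under eq_integral do rewrite -hE1; under [RHS]eq_integral do rewrite -hE2.
exact: fubini_tonelli.
Qed.

Lemma measurable_integral_section :
  measurable_fun A (fun x => \int[m2]_(y in B) f (x, y))%E.
Proof.
apply/(measurable_restrictT _ mA).
have := @measurable_fun_fubini_tonelli_F _ _ _ _ _ m2 _ mh h0.
by apply: eq_measurable_fun => x _; rewrite /fubini_F hE1.
Qed.

End tonelli_sets.

(** * Changes of variable: affine maps, reflections, shifts of periodic functions *)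

Section affine_substitution.
Context (R : realType).
Local Notation mu := (@lebesgue_measure R).

Let aff (c s x : R) : measurableTypeR R := c * x + s.

Let measurable_aff c s : measurable_fun [set: measurableTypeR R] (aff c s).
Proof. by apply: measurable_funD => //; exact: measurable_funM. Qed.

(** Uniqueness of the Lebesgue measure: c times its image under the affine map agrees with it on the
    intervals ]a, b]. *)
Lemma lebesgue_measure_affine (c s : R) (A : set R) : 0 < c -> measurable A ->
  mu A = (c%:E * mu ((fun x : R => (c * x + s)%R) @^-1` A))%E.
Proof.
move=> c0 mA.
pose nu := mscale (NngNum (ltW c0)) (pushforward mu (aff c s)).
apply: (@lebesgue_measure_unique R (nu (measurable_aff c s))) => // _ [[a b]] _ <-.
transitivity (c%:E * mu `]((a - s) / c)%R, ((b - s) / c)%R]%classic)%E; last first.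
  congr (_ * mu _)%E; apply/seteqP; split=> x /=; rewrite /aff !in_itv /=;
    by rewrite ltr_pdivrMr // ler_pdivlMr // ltrBlDr lerBrDr [x * c]mulrC.
rewrite !lebesgue_measure_itv /= !lte_fin ltr_pM2r ?invr_gt0 // ltrD2r.
case: ifPn => _; last by rewrite mule0.
rewrite -!EFinB -EFinM; congr EFin; field.
by rewrite gt_eqF.
Qed.

Lemma ge0_integral_affine (c s a b : R) (f : R -> \bar R) : 0 < c ->
  measurable_fun [set: R] f -> (forall x, 0 <= f x)%E ->
  (\int[mu]_(y in `](c * a + s)%R, (c * b + s)%R]) f y =
   c%:E * \int[mu]_(x in `]a, b]) f (c * x + s)%R)%E.
Proof.
move=> c0 mf f0.
pose nu := mscale (NngNum (ltW c0)) (pushforward mu (aff c s)).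
rewrite (@eq_measure_integral _ _ _ _ (nu (measurable_aff c s))) /=; last first.
  by move=> A mA _; apply: lebesgue_measure_affine.
rewrite ge0_integral_mscale //=; last exact: measurable_funTS.
rewrite ge0_integral_pushforward //=; last exact: measurable_funTS.
congr (_ * _)%E; congr (integral _ _ _).
apply/seteqP; split=> x /=; rewrite /aff !in_itv /=.
  by rewrite ltrD2r lerD2r ltr_pM2l // ler_pM2l.
by rewrite ltrD2r lerD2r ltr_pM2l // ler_pM2l.
Qed.

Lemma ge0_integral_reflect (s a b : R) (f : R -> \bar R) :
  measurable_fun [set: R] f -> (forall x, 0 <= f x)%E ->
  (\int[mu]_(x in `]a, b]) f (s - x)%R = \int[mu]_(y in `](s - b)%R, (s - a)%R]) f y)%E.
Proof.
move=> mf f0.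
have mfS : measurable_fun [set: R] (fun x => f (s + x)%R).
  by apply: (measurableT_comp mf); exact: measurable_funD.
transitivity (\int[mu]_(y in `[(- b)%R, (- a)%R[) f (s + y)%R)%E.
  have -> : `]a, b]%classic = (-%R : _ -> measurableTypeR R) @^-1` `[(- b)%R, (- a)%R[ :> set R.
    by apply/seteqP; split=> x /=; rewrite !in_itv /= lerN2 ltrN2 andbC.
  rewrite -(@ge0_integral_pushforward _ _ _ _ R
    (-%R : measurableTypeR R -> measurableTypeR R) _ mu _ (fun y => f (s + y)%R)) //=.
  2: exact: measurable_funS mfS.
  by apply: eq_measure_integral => //= A mA AS; rewrite lebesgue_measureN.
(* Reflection exchanges the open and the closed end; endpoints being negligible, the form ]a, b] is
   restored. *)
have -> : (\int[mu]_(y in `[(- b)%R, (- a)%R[) f (s + y)%R =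
    \int[mu]_(y in `](- b)%R, (- a)%R]) f (s + y)%R)%E.
  by rewrite [LHS]integral_itv_bndoo 1?[RHS]integral_itv_bndoo //; exact: measurable_funTS.
have := ge0_integral_affine 1 s (- b) (- a) f ltr01 mf f0.
rewrite !mul1r mul1e ![- _ + s]addrC => ->.
by apply: eq_integral => x _; rewrite mul1r addrC.
Qed.

End affine_substitution.

Lemma ge0_integral_itv_split (R : realType) (a b c : R) (f : R -> \bar R) :
  a <= b -> b <= c -> measurable_fun [set: R] f -> (forall x, 0 <= f x)%E ->
  (\int[@lebesgue_measure R]_(x in `]a, c]) f x =
   \int[@lebesgue_measure R]_(x in `]a, b]) f x +
   \int[@lebesgue_measure R]_(x in `]b, c]) f x)%E.
Proof.
move=> ab bc mf f0.
have -> : `]a, c]%classic = `]a, b] `|` `]b, c] :> set R.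
  by rewrite -itv_bndbnd_setU // bnd_simp.
apply: ge0_integral_setU => //; first exact: measurable_funTS.
apply/disj_setPS => x [/=]; rewrite !in_itv /= => /andP[_ xT] /andP[].
by rewrite ltNge xT.
Qed.

Section periodic.
Context (R : realType) (T : R) (f : R -> \bar R).
Hypotheses (T0 : 0 < T) (mf : measurable_fun [set: R] f)
  (f0 : forall x, (0 <= f x)%E) (fT : forall x, f (x + T) = f x).
Local Notation mu := (@lebesgue_measure R).

Let shift a b s : (\int[mu]_(x in `]a, b]) f (x + s)%R =
  \int[mu]_(x in `](a + s)%R, (b + s)%R]) f x)%E.
Proof.
have := ge0_integral_affine _ 1 s a b f ltr01 mf f0; rewrite mul1e !mul1r => ->.
by apply: eq_integral => x _; rewrite mul1r.
Qed.

(** For a shift t <= T the piece over ]T, T + t] is moved back to ]0, t]; a larger shift is first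
    reduced modulo T. *)
Lemma ge0_integral_periodic_shift s : 0 <= s ->
  (\int[mu]_(x in `]0%R, T]) f (x + s)%R = \int[mu]_(x in `]0%R, T]) f x)%E.
Proof.
have small t : 0 <= t <= T ->
    (\int[mu]_(x in `]0%R, T]) f (x + t)%R = \int[mu]_(x in `]0%R, T]) f x)%E.
  case/andP => t0 tT; rewrite shift add0r.
  have Ts : T <= T + t by rewrite lerDl.
  rewrite (ge0_integral_itv_split _ t T) //.
  have -> : (\int[mu]_(x in `]T, (T + t)%R]) f x = \int[mu]_(x in `]0%R, t]) f x)%E.
    have := shift 0 t T; rewrite add0r [t + T]addrC => <-.
    by apply: eq_integral => x _; rewrite fT.
  by rewrite addeC -ge0_integral_itv_split.
have sn n t : 0 <= t <= T ->
    (\int[mu]_(x in `]0%R, T]) f (x + (t + T * n%:R))%R = \int[mu]_(x in `]0%R, T]) f x)%E.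
  move=> ht; rewrite -(small t ht); apply: eq_integral => x _.
  elim: n => [|n IH]; first by rewrite mulr0 addr0.
  rewrite -IH -[in RHS]fT; congr f.
  by rewrite -addn1 natrD; ring.
move=> s0; pose n := Num.truncn (s / T).
have st0 : 0 <= s / T by rewrite divr_ge0 // ltW.
have /andP[n1 n2] := truncn_itv st0.
have -> : s = (s - T * n%:R) + T * n%:R by rewrite subrK.
apply: sn; rewrite subr_ge0 mulrC -ler_pdivlMr // n1 /=.
move: n2; rewrite ltr_pdivrMr // -natr1 => n2; nra.
Qed.

End periodic.

Section integral_total.
Context d (T : measurableType d) (R : realType) (mu : {measure set T -> \bar R}).
Variables (D : set T) (f g : T -> \bar R).
Hypotheses (mD : measurable D) (mf : measurable_fun setT f) (mg : measurable_fun setT g)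
  (f0 : forall x, (0 <= f x)%E) (g0 : forall x, (0 <= g x)%E).

Lemma ge0_integralD_total : (\int[mu]_(x in D) (f x + g x) =
  \int[mu]_(x in D) f x + \int[mu]_(x in D) g x)%E.
Proof. by rewrite ge0_integralD //; exact: measurable_funTS. Qed.

Lemma ge0_integralZl_total (c : R) : 0 <= c ->
  (\int[mu]_(x in D) (c%:E * f x) = c%:E * \int[mu]_(x in D) f x)%E.
Proof. by move=> c0; rewrite ge0_integralZl //; exact: measurable_funTS. Qed.

End integral_total.

Section integral_fin.
Context d (T : measurableType d) (R : realType) (mu : {measure set T -> \bar R}).
Variables (D : set T) (f g : T -> R).
Hypotheses (mD : measurable D) (mf : measurable_fun setT f) (mg : measurable_fun setT g)
  (f0 : forall x, 0 <= f x) (g0 : forall x, 0 <= g x).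

Lemma ge0_integralD_fin : (\int[mu]_(x in D) (f x + g x)%:E =
  \int[mu]_(x in D) (f x)%:E + \int[mu]_(x in D) (g x)%:E)%E.
Proof.
under eq_integral do rewrite EFinD.
rewrite ge0_integralD //; by [move=> x _; rewrite lee_fin|
  apply/measurable_EFinP; exact: measurable_funTS].
Qed.

Lemma ge0_integralZl_fin (c : R) : 0 <= c ->
  (\int[mu]_(x in D) (c * f x)%:E = c%:E * \int[mu]_(x in D) (f x)%:E)%E.
Proof.
move=> c0; under eq_integral do rewrite EFinM.
rewrite ge0_integralZl //; by [move=> x _; rewrite lee_fin|rewrite lee_fin|
  apply/measurable_EFinP; exact: measurable_funTS].
Qed.

End integral_fin.

Lemma measurable_chord (R : realType) : measurable_fun setT (chord R).
Proof.
apply: continuous_measurable_fun => x; apply: cvg_norm.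
apply: cvgM; first exact: cvg_cst.
apply: (@cvg_comp _ _ _ (fun x => x / 2)); last exact: continuous_sin.
by apply: cvgM; [exact: cvg_id|exact: cvg_cst].
Qed.

(** * The energy of a map with a continuous lifting *)

Section smooth_estimate.
Context (R : realType) (e : R) (phi : R -> R) (d : int).
Hypotheses (e0 : 0 < e) (cphi : continuous phi)
  (qphi : forall t, phi (t + 2 * pi) = phi t + 2 * pi * d%:~R).
Local Notation mu := (@lebesgue_measure R).
Local Notation circ := `]0%R, (2 * pi)%R]%classic.

Let pi0 : 0 < (pi : R) := pi_gt0 R.
Let pi20 : 0 < 2 * pi :> R. Proof. by rewrite mulr_gt0. Qed.

(** With v (e^(it)) = e^(i phi t) and p = 1 + e, this is |v (e^(ib)) - v (e^(ia))|^p by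
    [normc_expiB]. *)
Definition jump (a b : R) : R := chord R (phi b - phi a) `^ (1 + e).

Definition cocycle_const : R := e * ln 2 * 2 `^ e.

Lemma cocycle_const_ge0 : 0 <= cocycle_const.
Proof. by rewrite !mulr_ge0 ?powR_ge0 ?ln_ge0 ?ler1n // ltW. Qed.

Lemma jump_ge0 a b : 0 <= jump a b. Proof. exact: powR_ge0. Qed.

Lemma jumpC a b : jump a b = jump b a.
Proof. by rewrite /jump -chordN opprB. Qed.

Lemma jumpDl a b : jump (a + 2 * pi) b = jump a b.
Proof.
by rewrite /jump qphi opprD addrA -[- (_ * d%:~R)]mulrN -mulrNz chordDpi_int.
Qed.

Lemma jumpDr a b : jump a (b + 2 * pi) = jump a b.
Proof. by rewrite jumpC jumpDl jumpC. Qed.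

Lemma measurable_jump d1 (T : measurableType d1) (f g : T -> R) :
  measurable_fun setT f -> measurable_fun setT g ->
  measurable_fun setT (fun x => jump (f x) (g x)).
Proof.
move=> mf mg; have mphi : measurable_fun setT phi by exact: continuous_measurable_fun.
apply: (@measurableT_comp _ _ _ _ _ _ (@powR R ^~ (1 + e))) => //.
apply: (measurableT_comp (measurable_chord R)).
by apply: measurable_funB; exact: measurableT_comp.
Qed.

(** The bound produced by n bisections of [a, a + t]: each bisection adds the error term of
    [dist_angle_cocycle], and the final pieces are bounded as in [dist_angle_small]. *)
Fixpoint halving_bound (n : nat) (a t : R) : R :=
  if n is n.+1 then
    halving_bound n a (t / 2) + halving_bound n (a + t / 2) (t / 2) +
    cocycle_const * (jump a (a + t / 2) + jump (a + t / 2) (a + t / 2 + t / 2))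
  else 2 * jump a (a + t).

Lemma halving_bound_ge0 n a t : 0 <= halving_bound n a t.
Proof.
elim: n a t => [|n IH] a t /=; first by rewrite mulr_ge0 ?jump_ge0.
by rewrite !addr_ge0 // mulr_ge0 ?addr_ge0 ?jump_ge0 ?cocycle_const_ge0.
Qed.

Lemma halving_bound_periodic n a t :
  halving_bound n (a + 2 * pi) t = halving_bound n a t.
Proof.
elim: n a t => [|n IH] a t /=; first by rewrite jumpDl (addrAC a) jumpDr.
by rewrite IH (addrAC a _ (t / 2)) IH (addrAC _ (2 * pi) (t / 2)) !jumpDl !jumpDr.
Qed.

Lemma measurable_halving_bound d1 (T : measurableType d1) n (f g : T -> R) :
  measurable_fun setT f -> measurable_fun setT g ->
  measurable_fun setT (fun x => halving_bound n (f x) (g x)).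
Proof.
elim: n f g => [|n IH] f g mf mg /=.
  by apply: measurable_funM => //; apply: measurable_jump => //; exact: measurable_funD.
have mg2 : measurable_fun setT (fun x => g x / 2) by exact: measurable_funM.
have mfg : measurable_fun setT (fun x => f x + g x / 2) by exact: measurable_funD.
apply: measurable_funD; first by apply: measurable_funD; exact: IH.
apply: measurable_funM => //; apply: measurable_funD; apply: measurable_jump => //.
exact: measurable_funD.
Qed.

(** After n bisections the pieces are shorter than [del], so [phi] moves by less than 1 on them and
    [dist_angle_small] applies. *)
Lemma halving_boundP (del : R) : 
  (forall a b, `|b - a| < del -> `|phi b - phi a| < 1) ->
  forall n a t, 0 <= t -> t / 2 ^+ n < del ->
  `|dist_angle R e (phi (a + t) - phi a)| <= halving_bound n a t.
Proof.
move=> hdel; elim=> [|n IH] a t t0 /=.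
  rewrite expr0 divr1 => td; apply: dist_angle_small => //.
  by apply: hdel; rewrite addrAC subrr add0r ger0_norm.
move=> td; have t20 : 0 <= t / 2 by rewrite divr_ge0.
have td2 : t / 2 / 2 ^+ n < del by rewrite -mulrA -invfM -exprS.
have -> : a + t = a + t / 2 + t / 2 by rewrite -addrA -splitr.
have -> : phi (a + t / 2 + t / 2) - phi a =
    (phi (a + t / 2) - phi a) + (phi (a + t / 2 + t / 2) - phi (a + t / 2)).
  by ring.
apply: (le_trans (dist_angle_cocycle _ _ _ _ e0)); rewrite lerD //.
by apply: lerD; exact: IH.
Qed.

Definition jump_int (t : R) : \bar R := (\int[mu]_(a in circ) (jump a (a + t))%:E)%E.

Definition halving_int n (t : R) : \bar R :=
  (\int[mu]_(a in circ) (halving_bound n a t)%:E)%E.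

Lemma jump_int_ge0 t : (0 <= jump_int t)%E.
Proof. by apply: integral_ge0 => a _; rewrite lee_fin jump_ge0. Qed.

Lemma halving_int_ge0 n t : (0 <= halving_int n t)%E.
Proof. by apply: integral_ge0 => a _; rewrite lee_fin halving_bound_ge0. Qed.

Lemma measurable_jump_int : measurable_fun setT jump_int.
Proof.
have := @measurable_integral_section _ _ (measurableTypeR R) (measurableTypeR R) R mu
  setT circ (fun z => (jump z.2 (z.2 + z.1))%:E).
apply => //.
- apply/measurable_EFinP; apply: measurable_jump => //; exact: measurable_funD.
- by move=> z; rewrite lee_fin jump_ge0.
Qed.

Lemma measurable_halving_int n : measurable_fun setT (halving_int n).
Proof.
have := @measurable_integral_section _ _ (measurableTypeR R) (measurableTypeR R) R mu
  setT circ (fun z => (halving_bound n z.2 z.1)%:E).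
apply => //.
- by apply/measurable_EFinP; apply: measurable_halving_bound.
- by move=> z; rewrite lee_fin halving_bound_ge0.
Qed.

Let mjump (f g : R -> R) (D : set R) : measurable_fun setT f -> measurable_fun setT g ->
  measurable_fun D (fun a => (jump (f a) (g a))%:E).
Proof.
by move=> mf mg; apply/measurable_EFinP; apply: measurable_funTS; exact: measurable_jump.
Qed.

Let mhalv n (f : R -> R) t (D : set R) : measurable_fun setT f ->
  measurable_fun D (fun a => (halving_bound n (f a) t)%:E).
Proof.
by move=> mf; apply/measurable_EFinP; apply: measurable_funTS; exact: measurable_halving_bound.
Qed.

Let madd t : measurable_fun setT (fun a : R => a + t).
Proof. exact: measurable_funD. Qed.

Let e2 (x : \bar R) : ((2 : R)%:E * x = x + x)%E.
Proof. by rewrite (mule_natl x 2) mule2n. Qed.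

(** Integration over a full period removes the shift by t/2, so both halves contribute equally. *)
Lemma halving_int_S n t : 0 <= t ->
  halving_int n.+1 t = (2%:E * (halving_int n (t / 2) + cocycle_const%:E * jump_int (t / 2)))%E.
Proof.
move=> t0; have t20 : 0 <= t / 2 by rewrite divr_ge0.
rewrite /halving_int /=.
have c0 := cocycle_const_ge0.
have shH : (\int[mu]_(a in circ) (halving_bound n (a + t / 2)%R (t / 2))%:E =
    \int[mu]_(a in circ) (halving_bound n a (t / 2))%:E)%E.
  apply: (@ge0_integral_periodic_shift R (2 * pi) (fun a => (halving_bound n a (t / 2))%:E)) => //.
  - exact: mhalv.
  - by move=> x; rewrite lee_fin halving_bound_ge0.
  - by move=> x; rewrite halving_bound_periodic.
have shJ : (\int[mu]_(a in circ) (jump (a + t / 2)%R (a + t / 2 + t / 2)%R)%:E =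
    jump_int (t / 2))%E.
  apply: (@ge0_integral_periodic_shift R (2 * pi) (fun a => (jump a (a + t / 2))%:E)) => //.
  - exact: mjump.
  - by move=> x; rewrite lee_fin jump_ge0.
  - by move=> x; rewrite jumpDl (addrAC x) jumpDr.
have mshift : measurable_fun setT (fun x : R => x + t / 2) by exact: measurable_funD.
have mj1 : measurable_fun setT (fun x : R => jump x (x + t / 2)).
  exact: measurable_jump.
have mj2 : measurable_fun setT (fun x : R => jump (x + t / 2) (x + t / 2 + t / 2)).
  by apply: measurable_jump => //; exact: measurable_funD.
have mh1 : measurable_fun setT (fun x : R => halving_bound n x (t / 2)).
  exact: measurable_halving_bound.
have mh2 : measurable_fun setT (fun x : R => halving_bound n (x + t / 2) (t / 2)).
  exact: measurable_halving_bound.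
have mc : measurable (circ : set (measurableTypeR R)) by exact: measurable_itv.
have h0 x : 0 <= halving_bound n x (t / 2) + halving_bound n (x + t / 2) (t / 2).
  by rewrite addr_ge0 ?halving_bound_ge0.
have j0 x : 0 <= jump x (x + t / 2) + jump (x + t / 2) (x + t / 2 + t / 2).
  by rewrite addr_ge0 ?jump_ge0.
have mjj := measurable_funD mj1 mj2.
have mcj := measurable_funM (measurable_cst cocycle_const) mjj.
rewrite (ge0_integralD_fin _ _ _ mu circ _ _ mc (measurable_funD mh1 mh2) mcj h0
  (fun x => mulr_ge0 c0 (j0 x))).
rewrite (ge0_integralD_fin _ _ _ mu circ _ _ mc mh1 mh2
  (fun x => halving_bound_ge0 n x _) (fun x => halving_bound_ge0 n _ _)).
rewrite (ge0_integralZl_fin _ _ _ mu circ _ mc mjj j0 _ c0).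
rewrite (ge0_integralD_fin _ _ _ mu circ _ _ mc mj1 mj2
  (fun x => jump_ge0 x _) (fun x => jump_ge0 _ _)).
rewrite shH shJ.
have H0 := halving_int_ge0 n (t / 2); have J0 := jump_int_ge0 (t / 2).
have C0 : (0 <= cocycle_const%:E * jump_int (t / 2))%E by rewrite mule_ge0 // lee_fin.
by rewrite e2 (ge0_muleDr _ J0 J0) addeACA.
Qed.

End smooth_estimate.

Lemma measurable_invr_ge0 d (T : measurableType d) (R : realType) (D : set T)
  (f : T -> R) : measurable_fun D f -> (forall x, 0 <= f x) ->
  measurable_fun D (fun x => (f x)^-1).
Proof.
move=> mf f0; have -> : (fun x => (f x)^-1) = (fun x => f x `^ (- 1)).
  by apply/funext => x; rewrite powR_inv1.
by apply: (@measurableT_comp _ _ _ _ _ _ (@powR R ^~ (- 1))).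
Qed.

(** * Averages over dyadic scales *)

Section scale_integrals.
Context (R : realType) (e : R) (phi : R -> R) (d : int).
Hypotheses (e0 : 0 < e) (cphi : continuous phi)
  (qphi : forall t, phi (t + 2 * pi) = phi t + 2 * pi * d%:~R).
Local Notation mu := (@lebesgue_measure R).
Local Notation J := (jump_int R e phi).
Local Notation H := (halving_int R e phi).
Local Notation C := (cocycle_const R e).

Let pi0 : 0 < (pi : R) := pi_gt0 R.
Let mJ : measurable_fun setT J := measurable_jump_int R e phi cphi.
Let J0 t : (0 <= J t)%E := jump_int_ge0 R e phi t.

Definition scale_int (a b : R) : \bar R :=
  (\int[mu]_(t in `]a, b]) (J t * (t ^- 2)%:E))%E.

Let measurable_inv_sqr : measurable_fun setT (fun t : R => (t ^- 2)%:E).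
Proof.
apply/measurable_EFinP; apply: measurable_invr_ge0 => [|t]; last exact: sqr_ge0.
exact: exprn_measurable.
Qed.

Let inv_sqr_ge0 (t : R) : (0 <= (t ^- 2)%:E)%E.
Proof. by rewrite lee_fin invr_ge0 sqr_ge0. Qed.

Let mJ2 : measurable_fun setT (fun t => J t * (t ^- 2)%:E)%E.
Proof. exact: emeasurable_funM. Qed.

Let JI0 t : (0 <= J t * (t ^- 2)%:E)%E.
Proof. by rewrite mule_ge0. Qed.

Lemma scale_int_ge0 a b : (0 <= scale_int a b)%E.
Proof. by apply: integral_ge0 => t _; rewrite mule_ge0. Qed.

Lemma scale_int_split a b c : a <= b -> b <= c ->
  scale_int a c = (scale_int a b + scale_int b c)%E.
Proof.
by move=> ab bc; apply: ge0_integral_itv_split.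
Qed.

Definition halving_scale_int n T : \bar R :=
  (\int[mu]_(t in `]T, (2 * T)%R]) (H n t * (t ^- 2)%:E))%E.

Let mH2 n : measurable_fun setT (fun t => H n t * (t ^- 2)%:E)%E.
Proof. by apply: emeasurable_funM => //; exact: measurable_halving_int. Qed.

Lemma halving_scale_int0 T : halving_scale_int 0 T = (2%:E * scale_int T (2 * T))%E.
Proof.
rewrite /halving_scale_int -(@ge0_integralZl_total _ _ _ mu) //.
apply: eq_integral => t _; rewrite muleA; congr (_ * _)%E.
rewrite /halving_int /= (@ge0_integralZl_fin _ _ _ mu) //.
  by apply: measurable_jump => //; exact: measurable_funD.
by move=> x; exact: jump_ge0.
Qed.

(** Under t = 2s one has t^-2 dt = s^-2 ds / 2, which absorbs the factor 2 of [halving_int_S]; this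
    explains the choice of the weight t^-2. *)
Lemma halving_scale_intS n T : 0 < T ->
  halving_scale_int n.+1 T =
  (halving_scale_int n (T / 2) + C%:E * scale_int (T / 2) T)%E.
Proof.
move=> T0; have T20 : 0 < T / 2 by rewrite divr_gt0.
have C0 : (0 <= C%:E)%E by rewrite lee_fin cocycle_const_ge0.
pose F (s : R) := ((H n s + C%:E * J s) * (s ^- 2)%:E)%E.
have H0 s : (0 <= H n s)%E := halving_int_ge0 R e phi e0 n s.
have CJ0 s : (0 <= C%:E * J s)%E by rewrite mule_ge0.
have F0 s : (0 <= F s)%E by apply: mule_ge0 => //; exact: adde_ge0.
have mF : measurable_fun setT F.
  apply: emeasurable_funM => //; apply: emeasurable_funD.
    exact: measurable_halving_int.
  exact: measurable_funeM.
(* The integrand in the variable t, written through t/2 so that the affine substitution returns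
   [F]. *)
pose G t := ((2^-1 : R)%:E * F (2^-1 * t)%R)%E.
have mG : measurable_fun setT G.
  by apply: measurable_funeM; apply: (measurableT_comp mF); exact: measurable_funM.
have G0 t : (0 <= G t)%E by apply: mule_ge0; rewrite ?lee_fin ?invr_ge0.
transitivity (\int[mu]_(t in `](2 * (T / 2) + 0)%R, (2 * T + 0)%R]) G t)%E.
  have -> : 2 * (T / 2) + 0 = T by field.
  rewrite addr0 /halving_scale_int; apply: eq_integral => t.
  rewrite inE /= in_itv /= => /andP[Tt _]; have t0 : 0 < t by exact: lt_trans Tt.
  rewrite (halving_int_S R e phi d) // ?ltW // /G /F [2^-1 * t]mulrC.
  set X := (_ + _)%E.
  rewrite muleAC -EFinM muleCA -EFinM [RHS]muleC; congr (_%:E * _)%E; field.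
  by rewrite gt_eqF.
rewrite ge0_integral_affine //.
transitivity (\int[mu]_(s in `](T / 2)%R, T]) F s)%E.
  rewrite -(@ge0_integralZl_total _ _ _ mu) //; last first.
    apply: (measurableT_comp mG); apply: measurable_funD; last exact: measurable_cst.
    exact: measurable_funM.
  apply: eq_integral => s _; rewrite /G addr0 muleA -EFinM divff ?mul1e //.
  by rewrite mulrA mulVf // mul1r.
rewrite /F; under eq_integral do rewrite ge0_muleDl //.
rewrite (@ge0_integralD_total _ _ _ mu) //; last 3 first.
- by apply: emeasurable_funM => //; exact: measurable_funeM.
- by move=> s; rewrite mule_ge0.
- by move=> s; rewrite mule_ge0.
congr (_ + _)%E; first by rewrite /halving_scale_int [2 * _]mulrC divfK.
rewrite /scale_int -(@ge0_integralZl_total _ _ _ mu) ?cocycle_const_ge0 //.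
by apply: eq_integral => t _; rewrite muleA.
exact: mH2.
Qed.

(** The error terms of successive halvings live on adjacent intervals ]T/2^(k+1), T/2^k] and join
    into a single integral; only the bottom scale keeps the constant 2. *)
Lemma halving_scale_intE n T : 0 < T ->
  halving_scale_int n T =
  (2%:E * scale_int (T / 2 ^+ n) (2 * (T / 2 ^+ n)) + C%:E * scale_int (T / 2 ^+ n) T)%E.
Proof.
elim: n T => [|n IH] T T0.
  by rewrite expr0 divr1 halving_scale_int0 [scale_int T T]/scale_int set_itvoc0
    integral_set0 mule0 adde0.
have T20 : 0 < T / 2 by rewrite divr_gt0.
have p2 : (0 : R) < 2 ^+ n by rewrite exprn_gt0.
have le : T / 2 / 2 ^+ n <= T / 2.
  by rewrite ler_piMr ?(ltW T20) // invf_le1 // exprn_ege1 // ler1n.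
rewrite halving_scale_intS // IH // -addeA -ge0_muleDr ?scale_int_ge0 //.
rewrite -scale_int_split //; last by rewrite ler_pdivrMr // mulr_natr mulr2n lerDl ltW.
by have -> : T / 2 ^+ n.+1 = T / 2 / 2 ^+ n by rewrite exprS invfM mulrA.
Qed.

(** Periodicity turns the step 2 pi m - t into -t; translating a by t then gives the step t with its
    endpoints exchanged. *)
Lemma jump_int_reflect m t : 0 <= t -> J (2 * pi * m%:R - t) = J t.
Proof.
move=> t0; rewrite /jump_int.
transitivity (\int[mu]_(a in `]0%R, (2 * pi)%R]) (jump R e phi a (a - t)%R)%:E)%E.
  apply: eq_integral => a _; congr EFin.
  have -> : a + (2 * pi * m%:R - t) = a - t + 2 * pi * (m%:Z)%:~R by rewrite -pmulrn; ring.
  apply: (@periodic_int R R (jump R e phi a)) => x; exact: (jumpDr R e phi d).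
have := @ge0_integral_periodic_shift R (2 * pi) (fun a => (jump R e phi a (a - t))%:E).
move=> /(_ _ _ _ _ t t0)/wrap[||||<-].
- by rewrite mulr_gt0.
- apply/measurable_EFinP; apply: measurable_jump => //; exact: measurable_funB.
- by move=> x; rewrite lee_fin jump_ge0.
- by move=> x; rewrite (jumpDl _ _ _ d) // (addrAC x) (jumpDr _ _ _ d).
by apply: eq_integral => a _; rewrite addrK jumpC.
Qed.

(** * The kernel identity: comparison of t^-2 with the kernel of the energy *)

Definition inv_chord_sqr (t : R) : R := (chord R t ^+ 2)^-1.

Lemma inv_chord_sqr_ge0 t : 0 <= inv_chord_sqr t.
Proof. by rewrite invr_ge0 sqr_ge0. Qed.

Let measurable_inv_chord_sqr (c : R) :
  measurable_fun setT (fun t : R => inv_chord_sqr (t * c)).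
Proof.
apply: measurable_invr_ge0 => [|t]; last exact: sqr_ge0.
apply: measurable_funX; apply: (measurableT_comp (measurable_chord R)).
exact: measurable_funM.
Qed.

Lemma chord_sqr (x : R) : chord R x ^+ 2 = 4 * sin (x / 2) ^+ 2.
Proof. by rewrite /chord real_normK ?num_real // exprMn; congr (_ * _); ring. Qed.

(** With s and c the sine and cosine of x/2, this is 1/s^2 + 1/c^2 = 1/(s c)^2. *)
Lemma inv_chord_sqr_double (x : R) : 0 < x <= pi / 2 ->
  inv_chord_sqr x + inv_chord_sqr (pi - x) = 4 * inv_chord_sqr (2 * x).
Proof.
move=> hx; rewrite /inv_chord_sqr !chord_sqr.
have -> : (pi - x) / 2 = - (x / 2) + pi / 2 by field.
have -> : 2 * x / 2 = x / 2 + x / 2 by field.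
rewrite sinDpihalf cosN sinD.
have s0 : 0 < sin (x / 2) by apply: sin_gt0_pi; lra.
have c0 : 0 < cos (x / 2) by apply: cos_gt0_pihalf; lra.
set s := sin (x / 2) in s0 *; set c := cos (x / 2) in c0 *.
have sc : c ^+ 2 + s ^+ 2 = 1 := cos2Dsin2 _.
transitivity ((c ^+ 2 + s ^+ 2) / (4 * s ^+ 2 * c ^+ 2)).
  by field; rewrite !gt_eqF.
by rewrite sc; field; rewrite !gt_eqF // addr_gt0 // mulr_gt0.
Qed.

(** Equal to (2^(n+1) sin (t/2^(n+1)))^-2: the kernel of the energy for n = 0, of period 2^(n+1) pi,
    and tending to t^-2 as n grows. *)
Definition dyadic_kernel n (t : R) : R := (4 ^+ n)^-1 * inv_chord_sqr (t * (2 ^+ n)^-1).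

Let kernel_ge0 n t : 0 <= dyadic_kernel n t.
Proof. by rewrite mulr_ge0 ?inv_chord_sqr_ge0 // invr_ge0 exprn_ge0. Qed.

Let mkernel n : measurable_fun setT (fun t => (dyadic_kernel n t)%:E).
Proof.
by apply/measurable_EFinP; apply: measurable_funM => //; exact: measurable_inv_chord_sqr.
Qed.

Lemma dyadic_kernel_reflect n t : 0 < t <= 2 ^+ n * pi ->
  dyadic_kernel n.+1 t + dyadic_kernel n.+1 (2 ^+ n.+1 * pi - t) = dyadic_kernel n t.
Proof.
move=> /andP[t0 tn]; rewrite /dyadic_kernel -mulrDr.
have p2 : (0 : R) < 2 ^+ n by rewrite exprn_gt0.
set x := t * (2 ^+ n.+1)^-1.
have -> : (2 ^+ n.+1 * pi - t) * (2 ^+ n.+1)^-1 = pi - x.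
  by rewrite /x mulrBl [2 ^+ _ * pi]mulrC mulfK // gt_eqF // exprn_gt0.
have -> : t * (2 ^+ n)^-1 = 2 * x.
  by rewrite /x exprS; field; rewrite gt_eqF.
rewrite inv_chord_sqr_double.
  by rewrite mulrA [4 ^+ n.+1]exprSr invfM -[_ * 4]mulrA mulVf ?mulr1 // pnatr_eq0.
rewrite /x; apply/andP; split; first by rewrite divr_gt0 // exprn_gt0.
rewrite ler_pdivrMr ?exprn_gt0 // exprS.
by have -> : pi / 2 * (2 * 2 ^+ n) = 2 ^+ n * pi :> R by field.
Qed.

Lemma inv_sqr_le_kernel n t : 0 < t <= 2 ^+ n * pi -> t ^- 2 <= dyadic_kernel n t.
Proof.
move=> /andP[t0 tn]; rewrite /dyadic_kernel /inv_chord_sqr -invfM.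
have p2 : (0 : R) < 2 ^+ n by rewrite exprn_gt0.
set x := t * (2 ^+ n)^-1.
have tx : t = 2 ^+ n * x by rewrite /x mulrCA divff ?mulr1 // gt_eqF.
have x0 : 0 < x by rewrite divr_gt0.
have xpi : x <= pi by rewrite /x ler_pdivrMr // mulrC.
have E4 : (4 : R) ^+ n = (2 ^+ n) ^+ 2 by rewrite exprAC; congr (_ ^+ _); ring.
have s0 : 0 < sin (x / 2) by apply: sin_gt0_pi; lra.
(* The range of t keeps the chord away from 0, where its inverse would be 0. *)
rewrite lef_pV2 ?posrE ?exprn_gt0 //; last first.
  by rewrite E4 chord_sqr !mulr_gt0 // ?exprn_gt0.
rewrite E4 {1}tx exprMn ler_wpM2l ?sqr_ge0 // chord_sqr.
by have := sqr_sin_le R (x / 2); rewrite expr_div_n; lra.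
Qed.

Definition kernel_int n : \bar R :=
  (\int[mu]_(t in `]0%R, (2 ^+ n * pi)%R]) (J t * (dyadic_kernel n t)%:E))%E.

Let mJK n : measurable_fun setT (fun t => J t * (dyadic_kernel n t)%:E)%E.
Proof. exact: emeasurable_funM. Qed.

Let JK0 n t : (0 <= J t * (dyadic_kernel n t)%:E)%E.
Proof. by rewrite mule_ge0 ?lee_fin. Qed.

(** The interval is folded about its midpoint 2^n pi, since [J] is invariant under the reflection t
    -> 2^(n+1) pi - t. *)
Lemma kernel_int_split n :
  (\int[mu]_(t in `]0%R, (2 * (2 ^+ n * pi))%R]) (J t * (dyadic_kernel n.+1 t)%:E) =
   \int[mu]_(t in `]0%R, (2 ^+ n * pi)%R])
     (J t * (dyadic_kernel n.+1 t + dyadic_kernel n.+1 (2 ^+ n.+1 * pi - t))%:E))%E.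
Proof.
have p0 : 0 <= 2 ^+ n * pi :> R by rewrite mulr_ge0 ?exprn_ge0 // ltW.
rewrite (@ge0_integral_itv_split _ 0 (2 ^+ n * pi)) //; last first.
  by rewrite ler_peMl // ler1n.
pose K t := (J t * (dyadic_kernel n.+1 (2 ^+ n.+1 * pi - t))%:E)%E.
have -> : (\int[mu]_(t in `](2 ^+ n * pi)%R, (2 * (2 ^+ n * pi))%R])
    (J t * (dyadic_kernel n.+1 t)%:E) =
    \int[mu]_(t in `]0%R, (2 ^+ n * pi)%R]) K t)%E.
  have := @ge0_integral_reflect R (2 ^+ n.+1 * pi) 0 (2 ^+ n * pi) _ (mJK n.+1) (JK0 n.+1).
  have -> : 2 ^+ n.+1 * pi - 2 ^+ n * pi = 2 ^+ n * pi :> R by rewrite exprS; ring.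
  have -> : 2 * (2 ^+ n * pi) = 2 ^+ n.+1 * pi :> R by rewrite exprS mulrA.
  rewrite subr0 => <-; apply: eq_integral => t /set_mem ht.
  have /andP[t0 _] : 0 < t <= 2 ^+ n * pi := ht.
  have := jump_int_reflect (2 ^ n)%N t (ltW t0).
  have -> : 2 * pi * (2 ^ n)%N%:R = 2 ^+ n.+1 * pi :> R by rewrite natrX exprS; ring.
  by rewrite /K => ->.
rewrite -(@ge0_integralD_total _ _ _ mu) //; last 2 first.
- apply: emeasurable_funM => //.
  apply: (@measurableT_comp _ _ _ _ _ _ (fun t => (dyadic_kernel n.+1 t)%:E)) => //.
  exact: measurable_funB.
- by move=> t; rewrite mule_ge0 ?lee_fin.
by apply: eq_integral => t _; rewrite /K EFinD ge0_muleDr ?lee_fin.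
exact: mJK.
Qed.

(** After folding, [dyadic_kernel_reflect] merges the two kernels into that of level n. The integral
    thus keeps its value while the interval grows. *)
Lemma kernel_intS n : kernel_int n.+1 = kernel_int n.
Proof.
rewrite /kernel_int exprS -mulrA kernel_int_split; apply: eq_integral => t /set_mem ht.
by rewrite dyadic_kernel_reflect.
Qed.

(** The integrand is symmetric about pi; this is why only half of the energy enters the degree
    bound. *)
Lemma kernel_int0 :
  (\int[mu]_(t in `]0%R, (2 * pi)%R]) (J t * (inv_chord_sqr t)%:E) = 2%:E * kernel_int 0)%E.
Proof.
pose K t := (J t * (inv_chord_sqr t)%:E)%E.
have EK t : (J t * (dyadic_kernel 0 t)%:E)%E = K t.
  by rewrite /K /dyadic_kernel !expr0 invr1 mulr1 mul1r.
have mK : measurable_fun setT K.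
  by have := mJK 0; congr (measurable_fun _ _); apply/funext => t; exact: EK.
have K0 t : (0 <= K t)%E by rewrite -EK.
rewrite /kernel_int expr0 mul1r; under [in RHS]eq_integral do rewrite EK.
rewrite -/(K _) (@ge0_integral_itv_split _ 0 pi (2 * pi)) ?ler_peMl ?ler1n ?ltW //.
have -> : (\int[mu]_(x in `]pi, (2 * pi)%R]) K x = \int[mu]_(t in `]0%R, pi]) K t)%E.
  have := @ge0_integral_reflect R (2 * pi) 0 pi _ mK K0.
  have -> : 2 * pi - pi = pi :> R by ring.
  rewrite subr0 => <-; apply: eq_integral => t /set_mem ht.
  have /andP[t0 _] : 0 < t <= pi := ht.
  have ch : chord R (2 * pi - t) = chord R t.
    by rewrite -chordN opprB -chordDpi subrK.
  have := jump_int_reflect 1 t; rewrite mulr1 => Jt.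
  by rewrite /K /inv_chord_sqr ch Jt // ltW.
by rewrite -mule2n -mule_natl.
Qed.

(** On ]0, 2^n pi] the kernel of level n dominates t^-2, and its integral equals that of level 0. *)
Lemma scale_int_le n a : 0 <= a -> a <= 2 ^+ n * pi ->
  (2%:E * scale_int a (2 ^+ n * pi) <=
   \int[mu]_(t in `]0%R, (2 * pi)%R]) (J t * (inv_chord_sqr t)%:E))%E.
Proof.
move=> a0 an; rewrite kernel_int0.
have -> : kernel_int 0 = kernel_int n by elim: n {an} => // n ->; rewrite kernel_intS.
rewrite lee_pmul2l // ?lte_fin //.
apply: (@le_trans _ _ (scale_int 0 (2 ^+ n * pi))).
  rewrite (scale_int_split _ _ _ a0 an) -[leLHS]add0e leeD2r ?scale_int_ge0 //.
apply: ge0_le_integral => //.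
- exact: (measurable_funTS mJ2).
- exact: (measurable_funTS (mJK n)).
move=> t; rewrite /= in_itv /= => ht.
by rewrite lee_wpmul2l // lee_fin inv_sqr_le_kernel.
Qed.

End scale_integrals.

Lemma integral_inv_double (R : realType) (T : R) : 0 < T ->
  (\int[@lebesgue_measure R]_(t in `]T, (2 * T)%R]) (t^-1)%:E = (ln 2)%:E)%E.
Proof.
move=> T0; have T2 : T < 2 * T by rewrite ltr_pMl // ltr1n.
have cinv : {within `[T, 2 * T], continuous (fun t : R => t^-1)}.
  apply: continuous_in_subspaceT => t; rewrite inE /= in_itv /= => /andP[Tt _].
  by apply: cvgV; rewrite ?gt_eqF // (lt_le_trans T0).
rewrite integral_itv_obnd_cbnd; last first.
  apply/measurable_EFinP; apply: measurable_funS (subspace_continuous_measurable_fun _ cinv) => //.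
  by apply: subset_itv; rewrite bnd_simp.
rewrite (continuous_FTC2 T2 cinv (F := @ln R)).
- by rewrite lnM ?posrE // -EFinB addrK.
- split.
  + move=> t; rewrite in_itv /= => /andP[Tt _].
    by apply: ex_derive; apply: is_derive1_ln; exact: lt_trans Tt.
  + by apply: cvg_at_right_filter; apply: continuous_ln.
  + by apply: cvg_at_left_filter; apply: continuous_ln; rewrite mulr_gt0.
- move=> t; rewrite in_itv /= => /andP[Tt _].
  by rewrite derive1E; apply: derive_val; apply: is_derive1_ln; exact: lt_trans Tt.
Qed.

(** * The degree bound for a continuous lifting *)

Section lift_degree.
Context (R : realType) (e : R) (phi : R -> R) (d : int).
Hypotheses (e0 : 0 < e) (cphi : continuous phi)
  (qphi : forall t, phi (t + 2 * pi) = phi t + 2 * pi * d%:~R).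
Local Notation mu := (@lebesgue_measure R).
Local Notation J := (jump_int R e phi).
Local Notation H := (halving_int R e phi).
Local Notation C := (cocycle_const R e).
Local Notation HS := (halving_scale_int R e phi).
Local Notation SI := (scale_int R e phi).

(** The energy of the lifted map for p = 1 + e, by [energy_lift]. *)
Let X : \bar R :=
  (\int[mu]_(t in `]0%R, (2 * pi)%R]) (J t * (inv_chord_sqr R t)%:E))%E.

Let pi0 : 0 < (pi : R) := pi_gt0 R.

Let pi2_ge0 : 0 <= 2 * pi :> R. Proof. by apply: mulr_ge0 => //; exact: ltW. Qed.

Let X0 : (0 <= X)%E.
Proof.
by apply: integral_ge0 => t _; rewrite mule_ge0 ?jump_int_ge0 // lee_fin inv_chord_sqr_ge0.
Qed.

Let circ_cst (r : R) : (\int[mu]_(a in `]0%R, (2 * pi)%R]) r%:E = (2 * pi * r)%:E)%E.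
Proof.
rewrite (integral_cst mu) //= lebesgue_measure_itv /= lte_fin mulr_gt0 //.
by rewrite sube0 -EFinM mulrC.
Qed.

(** The increment of [phi] is d t up to M, and f is 2^e x up to 2^e pi; [halving_boundP] closes the
    chain, which is integrated over a. *)
Let halving_lower (M del : R) : 0 < del ->
  (forall a b, `|phi b - phi a - d%:~R * (b - a)| <= M) ->
  (forall a b, `|b - a| < del -> `|phi b - phi a| < 1) ->
  forall n t, 0 <= t -> t / 2 ^+ n < del ->
  ((2 * pi * (2 `^ e * `|d%:~R| * t))%:E <=
   H n t + (2 * pi * (2 `^ e * (pi + M)))%:E)%E.
Proof.
move=> del0 hM hdel n t t0 tn.
have M0 : 0 <= M by apply: le_trans (hM 0 0).
have p0 := powR_ge0 (2 : R) e.
rewrite -!circ_cst /halving_int -ge0_integralD_fin //; last 3 first.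
- exact: measurable_halving_bound.
- by move=> a; rewrite halving_bound_ge0.
- by move=> a; rewrite mulr_ge0 // addr_ge0 // ltW.
apply: ge0_le_integral => //.
- by move=> a _; rewrite lee_fin !mulr_ge0.
- apply/measurable_EFinP; apply: measurable_funTS; apply: measurable_funD => //.
  exact: measurable_halving_bound.
move=> a _; rewrite lee_fin.
have h1 := halving_boundP R e phi e0 del hdel n a t t0 tn.
have h2 := dist_angle_lower R e (phi (a + t) - phi a) e0.
have h3 := hM a (a + t); rewrite (addrC a t) addrK (addrC t a) in h3.
have h4 : `|d%:~R| * t - M <= `|phi (a + t) - phi a|.
  have := lerB_dist (d%:~R * t) (d%:~R * t - (phi (a + t) - phi a)).
  have -> : d%:~R * t - (d%:~R * t - (phi (a + t) - phi a)) = phi (a + t) - phi a.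
    by ring.
  by rewrite distrC normrM (ger0_norm t0); lra.
have := ler_wpM2l p0 h4; lra.
Qed.

(** Against t^-2 on ]T, 2T] the linear term becomes the integral of 1/t, which is ln 2 for every T,
    while the bounded error contributes at most a multiple of 1/T. *)
Let iteration_lower (M del : R) : 0 < del ->
  (forall a b, `|phi b - phi a - d%:~R * (b - a)| <= M) ->
  (forall a b, `|b - a| < del -> `|phi b - phi a| < 1) ->
  forall n T, 0 < T -> 2 * T / 2 ^+ n < del ->
  ((2 * pi * (2 `^ e * `|d%:~R|) * ln 2)%:E <=
   HS n T + (2 * pi * (2 `^ e * (pi + M)) / T)%:E)%E.
Proof.
move=> del0 hM hdel n T T0 Tn.
have M0 : 0 <= M by apply: le_trans (hM 0 0).
have p0 : 0 < 2 `^ e :> R by rewrite powR_gt0.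
set K := 2 * pi * (2 `^ e * (pi + M)).
have K0 : 0 <= K.
  by rewrite mulr_ge0 // mulr_ge0 ?(ltW p0) // addr_ge0 // ltW.
have L0 : 0 <= 2 * pi * (2 `^ e * `|d%:~R|) by rewrite mulr_ge0 // mulr_ge0 // ltW.
have mH2 : measurable_fun setT (fun t => H n t * (t ^- 2)%:E)%E.
  apply: emeasurable_funM; first exact: measurable_halving_int.
  apply/measurable_EFinP; apply: measurable_invr_ge0 => [|t]; last exact: sqr_ge0.
  exact: exprn_measurable.
have minv : measurable_fun setT (fun t : R => (t ^- 2)%:E).
  apply/measurable_EFinP; apply: measurable_invr_ge0 => [|t]; last exact: sqr_ge0.
  exact: exprn_measurable.
have ti0 (t : R) : (0 <= (t ^- 2)%:E)%E by rewrite lee_fin invr_ge0 sqr_ge0.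
have H20 t : (0 <= H n t * (t ^- 2)%:E)%E by rewrite mule_ge0 ?halving_int_ge0.
rewrite EFinM -(integral_inv_double _ _ T0).
have pos t : `]T, 2 * T]%classic t -> 0 < t.
  by rewrite /= in_itv /= => /andP[Tt _]; exact: lt_trans Tt.
have mpos : measurable_fun `]T, 2 * T]%classic (fun t : R => (t^-1)%:E).
  apply/measurable_EFinP; have : measurable_fun setT (fun t : R => `|t|^-1).
    by apply: measurable_invr_ge0 => //; exact: measurable_normr.
  move=> h; apply: eq_measurable_fun (measurable_funTS h) => t.
  by rewrite inE => /pos t0; rewrite gtr0_norm.
rewrite -ge0_integralZl ?lee_fin //; last first.
  by move=> t /pos t0; rewrite lee_fin invr_ge0 ltW.
apply: (@le_trans _ _ (\int[mu]_(t in `]T, (2 * T)%R]) (H n t * (t ^- 2)%:E + K%:E * (t ^- 2)%:E))%E).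
  apply: ge0_le_integral => //.
  - by move=> t /pos t0; rewrite mule_ge0 ?lee_fin // invr_ge0 ltW.
  - exact: measurable_funeM.
  - apply: measurable_funTS; apply: emeasurable_funD => //.
    exact: measurable_funeM.
  move=> t /[dup] /pos t0; rewrite /= in_itv /= => /andP[_ t2T].
  have tn : t / 2 ^+ n < del.
    by apply: le_lt_trans Tn; rewrite ler_pM2r // invr_gt0 exprn_gt0.
  have := halving_lower M del del0 hM hdel n t (ltW t0) tn.
  rewrite -/K => h; rewrite -ge0_muleDl ?halving_int_ge0 ?lee_fin //.
  have := lee_wpmul2r (ti0 t) h; apply: le_trans.
  rewrite -!EFinM lee_fin le_eqVlt; apply/orP; left; apply/eqP; field.
  by rewrite gt_eqF.
rewrite (@ge0_integralD_total _ _ _ mu) //; last 2 first.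
- exact: measurable_funeM.
- by move=> t; apply: mule_ge0 => //; rewrite lee_fin.
rewrite leeD2l //.
rewrite (@ge0_integralZl_total _ _ _ mu) // [leRHS]EFinM.
rewrite lee_wpmul2l ?lee_fin //.
apply: (@le_trans _ _ (\int[mu]_(t in `]T, (2 * T)%R]) (T ^- 2)%:E)%E).
  apply: ge0_le_integral => //; first exact: measurable_funTS.
  move=> t /[dup] /pos t0; rewrite /= in_itv /= => /andP[/ltW Tt _].
  by rewrite lee_fin lef_pV2 ?posrE ?exprn_gt0 // ler_sqr ?nnegrE ?(ltW T0) ?(ltW t0).
rewrite (integral_cst mu) //= lebesgue_measure_itv /= lte_fin ltr_pMl // ltr1n.
rewrite -EFinB -EFinM lee_fin le_eqVlt; apply/orP; left; apply/eqP; field.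
by rewrite gt_eqF.
Qed.

(** The intervals are disjoint dyadic pieces, and together they contribute at most the finite [X].
    If from [n0] on each exceeded [th], their sum would be unbounded. *)
Let small_tail (m n0 : nat) (th : R) : (X < +oo)%E -> 0 < th ->
  exists2 n, (n0 <= n)%N &
  (SI (2 ^+ m * pi / 2 ^+ n) (2 * (2 ^+ m * pi / 2 ^+ n)) <= th%:E)%E.
Proof.
move=> Xoo th0; set T := 2 ^+ m * pi.
have T0 : 0 < T by rewrite mulr_gt0 // exprn_gt0.
apply: contrapT => /forall2NP no.
have big n : (n0 <= n)%N -> (th%:E < SI (T / 2 ^+ n) (2 * (T / 2 ^+ n)))%E.
  by move=> hn; have [//|/negP] := no n; rewrite -ltNge.
have Tn n : 0 < T / 2 ^+ n by rewrite divr_gt0 // exprn_gt0.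
have Tdec n : T / 2 ^+ n.+1 <= T / 2 ^+ n.
  by rewrite ler_pM2l // lef_pV2 ?posrE ?exprn_gt0 // exprS ler_peMl ?exprn_ge0 // ler1n.
have Tdecm n k : T / 2 ^+ (n + k) <= T / 2 ^+ n.
  elim: k => [|k IH]; first by rewrite addn0.
  by rewrite addnS (le_trans (Tdec _)).
have sum k : ((k%:R * th)%:E <= SI (T / 2 ^+ (n0 + k)) (T / 2 ^+ n0))%E.
  elim: k => [|k IH]; first by rewrite mul0r scale_int_ge0.
  rewrite addnS (scale_int_split R e phi cphi _ (T / 2 ^+ (n0 + k))) //.
  rewrite -natr1 mulrDl mul1r addrC EFinD leeD //.
  have h : T / 2 ^+ (n0 + k) = 2 * (T / 2 ^+ (n0 + k).+1).
    by rewrite exprS; field; rewrite expf_neq0 // pnatr_eq0.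
  by rewrite [X in (_ <= SI _ X)%E]h ltW // big // -addnS leq_addr.
have Xfin : X = (fine X)%:E by rewrite fineK // ge0_fin_numE.
have bound k : k%:R * th <= fine X.
  rewrite -lee_fin -Xfin; apply: (le_trans (sum k)).
  have Tle : T / 2 ^+ n0 <= T by have := Tdecm 0 n0; rewrite add0n expr0 divr1.
  have := scale_int_le R e phi d cphi qphi m (T / 2 ^+ (n0 + k)) (ltW (Tn _)).
  move=> /(_ (le_trans (Tdecm _ _) Tle)); apply: le_trans.
  rewrite (scale_int_split R e phi cphi _ (T / 2 ^+ n0) T) // mule_natl mule2n.
  rewrite -[leLHS]adde0; apply: leeD; last by rewrite adde_ge0 ?scale_int_ge0.
  by rewrite -[leLHS]adde0; apply: leeD => //; exact: scale_int_ge0.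
have := archi_boundP (divr_ge0 (fine_ge0 X0) (ltW th0)).
rewrite ltr_pdivrMr // ltNge => /negP; apply; exact: bound.
Qed.

Lemma lift_degree_bound : ((4 * pi * `|d%:~R|)%:E <= e%:E * X)%E.
Proof.
have [Xoo|] := ltP X +oo%E; last first.
  by rewrite leye_eq => /eqP ->; rewrite gt0_muley ?lte_fin // leey.
have Xfin : X = (fine X)%:E by rewrite fineK // ge0_fin_numE.
set x := fine X in Xfin; rewrite Xfin -EFinM lee_fin.
have [M hM] := lift_growth R phi d cphi qphi.
have [del del0 hdel] := lift_unif_continuous R phi d cphi qphi.
have M0 : 0 <= M by apply: le_trans (hM 0 0).
have p0 : 0 < 2 `^ e :> R by rewrite powR_gt0.
have ln20 : 0 < ln (2 : R) by rewrite ln_gt0 // ltr1n.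
set K := 2 * pi * (2 `^ e * (pi + M)).
have K0 : 0 <= K.
  by rewrite mulr_ge0 // mulr_ge0 ?(ltW p0) // addr_ge0 // ltW.
have C0 : 0 <= C by exact: cocycle_const_ge0.
(* The common factor 2^e ln 2 / 2 is divided out, which leaves 4 pi |d| <= e x. *)
suff main eta : 0 < eta ->
    2 * pi * (2 `^ e * `|d%:~R|) * ln 2 <= C * x / 2 + eta.
  have : 2 * pi * (2 `^ e * `|d%:~R|) * ln 2 <= C * x / 2 by apply/ler_addgt0Pr.
  rewrite /cocycle_const.
  have -> : 2 * pi * (2 `^ e * `|d%:~R|) * ln 2 =
    (4 * pi * `|d%:~R|) * (2 `^ e * ln 2 / 2) :> R by field.
  have -> : e * ln 2 * 2 `^ e * x / 2 = e * x * (2 `^ e * ln 2 / 2) by field.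
  by rewrite ler_pM2r // divr_gt0 // mulr_gt0.
move=> eta0.
(* T = 2^m pi is taken so large that the error K/T is at most eta/2. *)
have [m hm] : exists m, K / (2 ^+ m * pi) <= eta / 2.
  have k0 : 0 <= K / (eta / 2) / pi by rewrite divr_ge0 ?(ltW pi0) // divr_ge0 // divr_ge0 // ltW.
  exists (Num.bound (K / (eta / 2) / pi)).
  have := archi_boundP k0; set m := Num.bound _ => h.
  have h2 : (m%:R : R) <= 2 ^+ m by rewrite -natrX ler_nat ltnW // ltn_expl.
  rewrite ler_pdivrMr ?mulr_gt0 ?exprn_gt0 // [eta / 2 * _]mulrC -ler_pdivrMr ?divr_gt0 //.
  by rewrite -ler_pdivrMr // (le_trans (ltW h)).
set T := 2 ^+ m * pi in hm.
have T0 : 0 < T by rewrite mulr_gt0 // exprn_gt0.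
(* From [n0] halvings on, all steps up to 2T are cut into pieces shorter than [del]. *)
pose n0 := Num.bound (2 * T / del).
have hn0 n : (n0 <= n)%N -> 2 * T / 2 ^+ n < del.
  move=> hn; rewrite ltr_pdivrMr ?exprn_gt0 // [del * _]mulrC -ltr_pdivrMr //.
  have k0 : 0 <= 2 * T / del by rewrite divr_ge0 ?mulr_ge0 // ltW.
  apply: (lt_le_trans (archi_boundP k0)); rewrite -/n0 -natrX ler_nat.
  by rewrite (leq_trans hn) // ltnW // ltn_expl.
(* With T fixed, n makes the bottom scale small: it enters with factor 2, so eta/4 costs eta/2. *)
have [n n0n hn] := small_tail m n0 (eta / 4) Xoo (divr_gt0 eta0 (ltr0Sn _ _)).
rewrite -/T in hn.
have := iteration_lower M del del0 hM hdel n T T0 (hn0 n n0n).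
rewrite -/K (halving_scale_intE R e phi d e0 cphi qphi n T T0).
have Tn0 : 0 < T / 2 ^+ n by rewrite divr_gt0 // exprn_gt0.
have Tn : T / 2 ^+ n <= T by rewrite ler_pdivrMr ?exprn_gt0 // ler_peMr ?(ltW T0) // exprn_ege1 // ler1n.
have hS : (C%:E * SI (T / 2 ^+ n)%R T <= (C * x / 2)%:E)%E.
  have := scale_int_le R e phi d cphi qphi m (T / 2 ^+ n) (ltW Tn0) Tn.
  rewrite -/X Xfin -/T => h.
  have h2 := lee_wpmul2l (_ : (0 <= (C / 2)%:E)%E) h.
  have -> : (C * x / 2)%:E = ((C / 2)%:E * x%:E)%E by rewrite -EFinM; congr EFin; ring.
  apply: le_trans (h2 _); last by rewrite lee_fin divr_ge0.
  by rewrite muleA -EFinM divfK // pnatr_eq0.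
move=> h; rewrite -lee_fin; apply: (le_trans h).
have -> : (C * x / 2 + eta)%:E = ((2 * (eta / 4))%:E + (C * x / 2)%:E + (eta / 2)%:E)%E.
  by rewrite -!EFinD; congr EFin; field.
rewrite !leeD // ?lee_fin // EFinM lee_wpmul2l // lee_fin.
Qed.

End lift_degree.

(** * From liftings to maps in [W^(1/p,p)] *)

Section completed_integrals.
Context (R : realType).
Local Notation mu := (@lebesgue_measure R).
Local Notation cmu := (@completed_lebesgue_measure R).

Lemma measurable_lebesgueR (f : R -> R) :
  measurable_fun [set: R] f -> measurable_fun setT (f : lebesgueR R -> R).
Proof.
move=> mf _ B mB; rewrite setTI; apply: sub_caratheodory.
by rewrite -[_ @^-1` _]setTI; exact: mf.
Qed.

Lemma measurable_id_lebesgueR :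
  measurable_fun [set: lebesgueR R] (id : lebesgueR R -> measurableTypeR R).
Proof.
by move=> _ B mB; rewrite setTI preimage_id; exact: sub_caratheodory.
Qed.

(** The identity from the Lebesgue to the Borel sigma-algebra pushes the completed measure forward
    to the Lebesgue measure. *)
Lemma completed_integralE (D : set R) (f : R -> \bar R) :
  measurable D -> measurable_fun [set: R] f -> (forall x, (0 <= f x)%E) ->
  (\int[cmu]_(x in D) f x = \int[mu]_(x in D) f x)%E.
Proof.
move=> mD mf f0.
have := @ge0_integral_pushforward _ _ (lebesgueR R) (measurableTypeR R) R id
  measurable_id_lebesgueR cmu D f mD.
move=> /(_ (measurable_funTS mf)) <-; last by move=> x _; exact: f0.
by apply: eq_measure_integral; first exact: measurable_id_lebesgueR.
Qed.

End completed_integrals.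

Lemma expiD2pi (R : realType) (t : R) : expi (t + 2 * pi) = expi t.
Proof.
apply: val_inj => /=; have -> : 2 * pi = pi *+ 2 :> R by ring.
by rewrite cosD2pi sinD2pi.
Qed.

Lemma normc_expi_sub (R : realType) (s t : R) :
  Normc.normc (val (expi s) - val (expi t)) = chord R (t - s).
Proof. by rewrite normc_expiB -chordN opprB. Qed.

(** Periodicity allows b = a + t in the inner integral; Tonelli then puts the integral over a
    inside, where the kernel depends on t only. *)
Lemma energy_lift (R : realType) (p : R) (v : circle R -> circle R) (phi : R -> R)
  (d : int) : 1 < p -> continuous phi ->
  (forall t, phi (t + 2 * pi) = phi t + 2 * pi * d%:~R) ->
  (forall t, v (expi t) = expi (phi t)) ->
  energy p v = (\int[@lebesgue_measure R]_(t in `]0%R, (2 * pi)%R])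
     (jump_int R (p - 1) phi t * (inv_chord_sqr R t)%:E))%E.
Proof.
move=> p1 cphi qphi vphi; have pi0 := pi_gt0 R.
pose mu := @lebesgue_measure R.
pose G a b := jump R (p - 1) phi a b * inv_chord_sqr R (b - a).
have G0 a b : 0 <= G a b by rewrite mulr_ge0 ?jump_ge0 ?inv_chord_sqr_ge0.
have mG d1 (T : measurableType d1) (f g : T -> R) :
    measurable_fun setT f -> measurable_fun setT g ->
    measurable_fun setT (fun x => (G (f x) (g x))%:E).
  move=> mf mg; apply/measurable_EFinP; apply: measurable_funM.
    exact: measurable_jump.
  apply: measurable_invr_ge0 => [|x]; last exact: sqr_ge0.
  apply: measurable_funX; apply: (measurableT_comp (measurable_chord R)).
  exact: measurable_funB.
have cc (f : R -> \bar R) : measurable_fun [set: R] f -> (forall x, (0 <= f x)%E) ->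
    (\int[@completed_lebesgue_measure R]_(x in `[0%R, (2 * pi)%R]) f x =
     \int[mu]_(x in `]0%R, (2 * pi)%R]) f x)%E.
  move=> mf f0; rewrite completed_integralE // -integral_itv_obnd_cbnd //.
  exact: measurable_funTS.
have Gint a : (\int[@completed_lebesgue_measure R]_(b in `[0%R, (2 * pi)%R]) (G a b)%:E =
     \int[mu]_(b in `]0%R, (2 * pi)%R]) (G a b)%:E)%E.
  by apply: cc => [|b]; [exact: mG|rewrite lee_fin].
transitivity (\int[@completed_lebesgue_measure R]_(a in `[0%R, (2 * pi)%R])
   \int[mu]_(b in `]0%R, (2 * pi)%R]) (G a b)%:E)%E.
  apply: eq_integral => a _; rewrite -Gint; apply: eq_integral => b _.
  rewrite !vphi !normc_expi_sub /G /jump /inv_chord_sqr.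
  by have -> : 1 + (p - 1) = p by ring.
have mGi : measurable_fun [set: R]
    (fun a => \int[mu]_(b in `]0%R, (2 * pi)%R]) (G a b)%:E)%E.
  have := @measurable_integral_section _ _ (measurableTypeR R) (measurableTypeR R) R mu
    setT `]0%R, (2 * pi)%R]%classic (fun z => (G z.1 z.2)%:E).
  apply => //; first exact: mG.
  by move=> z; rewrite lee_fin.
rewrite cc //; last by move=> a; apply: integral_ge0 => b _; rewrite lee_fin.
transitivity (\int[mu]_(a in `]0%R, (2 * pi)%R])
   \int[mu]_(t in `]0%R, (2 * pi)%R]) (G a (a + t)%R)%:E)%E.
  apply: eq_integral => a; rewrite inE /= in_itv /= => /andP[a0 _].
  have := @ge0_integral_periodic_shift R (2 * pi) (fun b => (G a b)%:E).
  move=> /(_ _ _ _ _ a (ltW a0))/wrap[||||<-].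
  - by rewrite mulr_gt0.
  - exact: mG.
  - by move=> x; rewrite lee_fin.
  - by move=> x; rewrite /G (jumpDr _ _ _ d) // addrAC /inv_chord_sqr chordDpi.
  by apply: eq_integral => t _; rewrite addrC.
have := @tonelli_set _ _ (measurableTypeR R) (measurableTypeR R) R mu mu
  `]0%R, (2 * pi)%R]%classic `]0%R, (2 * pi)%R]%classic (fun z => (G z.1 (z.1 + z.2))%:E).
move=> -> //; last 2 first.
- by apply: mG => //; exact: measurable_funD.
- by move=> z; rewrite lee_fin.
apply: eq_integral => t _; rewrite /jump_int muleC.
rewrite -(@ge0_integralZl_fin _ _ _ mu) ?inv_chord_sqr_ge0 //; last 2 first.
- by apply: measurable_jump => //; exact: measurable_funD.
- by move=> x; exact: jump_ge0.
apply: eq_integral => a _; rewrite /G /= mulrC; congr (_ * _)%:E.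
by congr inv_chord_sqr; rewrite addrAC subrr add0r.
Qed.

Lemma degree_bound (R : realType) (p : R) (v : circle R -> circle R) (d : int) :
  1 < p -> is_degree v d ->
  ((4 * pi * `|d%:~R|)%:E <= (p - 1)%:E * energy p v)%E.
Proof.
move=> p1 [phi [cphi vphi degphi]].
have qphi : forall t, phi (t + 2 * pi) = phi t + 2 * pi * d%:~R.
  by apply: lift_quasi_periodic => // t; rewrite -!vphi expiD2pi.
rewrite (energy_lift _ _ _ _ d p1 cphi qphi vphi).
by apply: lift_degree_bound => //; rewrite subr_gt0.
Qed.

(** * Comparison of the energies of nearby maps *)

Section perturbation.
Context (R : realType) (p : R).
Hypothesis p1 : 1 < p.
Local Notation cmu := (@completed_lebesgue_measure R).

(** Complex-valued counterpart of [circle_measurable], since the difference of two circle maps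
    leaves the circle. *)
Definition lebesgue_measurable_map (f : circle R -> R[i]) :=
  measurable_fun [set: lebesgueR R] ((fun t : R => complex.Re (f (expi t))) : lebesgueR R -> R) /\
  measurable_fun [set: lebesgueR R] ((fun t : R => complex.Im (f (expi t))) : lebesgueR R -> R).

Lemma normcE (z : R[i]) :
  Normc.normc z = Num.sqrt (complex.Re z ^+ 2 + complex.Im z ^+ 2).
Proof. by case: z. Qed.

Lemma normc_ge0 (z : R[i]) : 0 <= Normc.normc z.
Proof. by rewrite normcE sqrtr_ge0. Qed.

Let integrand (f : circle R -> R[i]) (z : R * R) : R :=
  Normc.normc (f (expi z.1) - f (expi z.2)) `^ p /
  Normc.normc (val (expi z.1) - val (expi z.2)) ^+ 2.

Let integrand_ge0 f z : 0 <= integrand f z.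
Proof. by rewrite mulr_ge0 ?powR_ge0 // invr_ge0 sqr_ge0. Qed.

Let measurable_integrand f : lebesgue_measurable_map f ->
  measurable_fun [set: lebesgueR R * lebesgueR R] (EFin \o integrand f).
Proof.
move=> [mRe mIm]; apply/measurable_EFinP.
have Re1 : measurable_fun [set: lebesgueR R * lebesgueR R]
    (fun z => complex.Re (f (expi z.1))) by exact: (measurableT_comp mRe).
have Re2 : measurable_fun [set: lebesgueR R * lebesgueR R]
    (fun z => complex.Re (f (expi z.2))) by exact: (measurableT_comp mRe).
have Im1 : measurable_fun [set: lebesgueR R * lebesgueR R]
    (fun z => complex.Im (f (expi z.1))) by exact: (measurableT_comp mIm).
have Im2 : measurable_fun [set: lebesgueR R * lebesgueR R]
    (fun z => complex.Im (f (expi z.2))) by exact: (measurableT_comp mIm).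
apply: measurable_funM.
  apply: (@measurableT_comp _ _ _ _ _ _ (@powR R ^~ p)) => //.
  have -> : (fun z : lebesgueR R * lebesgueR R => Normc.normc (f (expi z.1) - f (expi z.2))) =
    (fun z => Num.sqrt ((complex.Re (f (expi z.1)) - complex.Re (f (expi z.2))) ^+ 2 +
      (complex.Im (f (expi z.1)) - complex.Im (f (expi z.2))) ^+ 2)).
    by apply/funext => z; rewrite normcE; case: (f (expi z.1)); case: (f (expi z.2)).
  apply: (@measurableT_comp _ _ _ _ _ _ (@Num.sqrt R)).
    by apply: continuous_measurable_fun; exact: sqrt_continuous.
  by apply: measurable_funD; apply: measurable_funX; exact: measurable_funB.
apply: measurable_invr_ge0 => [|z]; last exact: sqr_ge0.
apply: measurable_funX.
have -> : (fun z : lebesgueR R * lebesgueR R => Normc.normc (val (expi z.1) - val (expi z.2))) =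
  (fun z => chord R (z.2 - z.1)) by apply/funext => z; rewrite normc_expi_sub.
apply: (measurableT_comp (measurable_chord R)).
have mid : measurable_fun setT (id : lebesgueR R -> R) by exact: measurable_lebesgueR.
apply: measurable_funB.
  by have := measurableT_comp mid (@measurable_snd _ _ (lebesgueR R) (lebesgueR R)).
by have := measurableT_comp mid (@measurable_fst _ _ (lebesgueR R) (lebesgueR R)).
Qed.

Let gagliardoE f : gagliardo p f =
  (\int[cmu]_(t in `[0%R, (2 * pi)%R]) \int[cmu]_(s in `[0%R, (2 * pi)%R])
     (integrand f (t, s))%:E)%E.
Proof. by []. Qed.

Let mI : measurable (`[0%R, (2 * pi)%R]%classic : set (lebesgueR R)).
Proof. by apply: sub_caratheodory; exact: measurable_itv. Qed.

Lemma gagliardo_ge0 f : (0 <= gagliardo p f)%E.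
Proof.
rewrite gagliardoE; apply: integral_ge0 => t _; apply: integral_ge0 => s _.
by rewrite lee_fin integrand_ge0.
Qed.

Lemma gagliardo_le_weighted (l : R) (f g h : circle R -> R[i]) : 0 < l < 1 ->
  lebesgue_measurable_map f -> lebesgue_measurable_map g -> lebesgue_measurable_map h ->
  (forall x y, Normc.normc (f x - f y) <=
     Normc.normc (g x - g y) + Normc.normc (h x - h y)) ->
  (gagliardo p f <= (l `^ (1 - p))%:E * gagliardo p g +
     ((1 - l) `^ (1 - p))%:E * gagliardo p h)%E.
Proof.
move=> l01 mf mg mh fgh; set a := l `^ _; set b := (1 - l) `^ _.
have a0 : 0 <= a by exact: powR_ge0.
have b0 : 0 <= b by exact: powR_ge0.
pose I : set (lebesgueR R) := `[0%R, (2 * pi)%R]%classic.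
pose inner q (t : lebesgueR R) : \bar R := (\int[cmu]_(s in I) (integrand q (t, s))%:E)%E.
have inner0 q t : (0 <= inner q t)%E.
  by apply: integral_ge0 => s _; rewrite lee_fin integrand_ge0.
have minner q : lebesgue_measurable_map q -> measurable_fun setT (inner q).
  move=> mq; have := @measurable_integral_section _ _ (lebesgueR R) (lebesgueR R) R cmu
    setT I (EFin \o integrand q).
  apply => //; first exact: measurable_integrand.
  by move=> z; rewrite lee_fin integrand_ge0.
have msec q t : lebesgue_measurable_map q -> measurable_fun setT
    (fun s : lebesgueR R => (integrand q (t, s))%:E).
  move=> mq; have := measurableT_comp (measurable_integrand _ mq)
    (@measurable_pair1 _ _ (lebesgueR R) (lebesgueR R) t).
  exact.
have Eg q : gagliardo p q = (\int[cmu]_(t in I) inner q t)%E by exact: gagliardoE.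
rewrite (Eg f) (Eg g) (Eg h).
have i0 q z : (0 <= (integrand q z)%:E)%E by rewrite lee_fin integrand_ge0.
have lin (G H : lebesgueR R -> \bar R) : measurable_fun setT G -> measurable_fun setT H ->
    (forall x, 0 <= G x)%E -> (forall x, 0 <= H x)%E ->
    (a%:E * \int[cmu]_(t in I) G t + b%:E * \int[cmu]_(t in I) H t =
     \int[cmu]_(t in I) (a%:E * G t + b%:E * H t))%E.
  move=> mG mH G0 H0.
  have aG0 x : (0 <= a%:E * G x)%E by apply: mule_ge0.
  have bH0 x : (0 <= b%:E * H x)%E by apply: mule_ge0.
  rewrite (ge0_integralD_total _ _ _ cmu I (fun t => a%:E * G t)%E (fun t => b%:E * H t)%E
    mI (measurable_funeM _ mG) (measurable_funeM _ mH) aG0 bH0).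
  by rewrite (ge0_integralZl_total _ _ _ cmu I G mI mG G0 a a0)
    (ge0_integralZl_total _ _ _ cmu I H mI mH H0 b b0).
(* Serves for the inner and for the outer integral alike. *)
have mono (F G H : lebesgueR R -> \bar R) : measurable_fun setT F ->
    measurable_fun setT G -> measurable_fun setT H -> (forall x, 0 <= F x)%E ->
    (forall x, 0 <= G x)%E -> (forall x, 0 <= H x)%E ->
    (forall x, F x <= a%:E * G x + b%:E * H x)%E ->
    (\int[cmu]_(t in I) F t <=
     a%:E * \int[cmu]_(t in I) G t + b%:E * \int[cmu]_(t in I) H t)%E.
  move=> mF mG mH F0 G0 H0 FGH; rewrite (lin G H mG mH G0 H0).
  apply: ge0_le_integral.
  - exact: mI.
  - by move=> x _.
  - exact: (measurable_funTS mF).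
  - by apply: measurable_funTS; apply: emeasurable_funD; apply: measurable_funeM.
  - by move=> x _; exact: FGH.
apply: (mono (inner f) (inner g) (inner h)); try exact: minner; try exact: inner0.
move=> t; apply: mono; try exact: msec; try by move=> s; exact: i0.
move=> s; rewrite -!EFinM -EFinD lee_fin /integrand !mulrA -mulrDl.
rewrite ler_wpM2r ?invr_ge0 ?sqr_ge0 //.
apply: le_trans (powRD_le_weighted _ _ _ _ _ (ltW p1) l01 (normc_ge0 _) (normc_ge0 _)).
by rewrite ge0_ler_powR ?nnegrE ?addr_ge0 ?normc_ge0 // ltW // (lt_trans ltr01).
Qed.

(** Triangle inequality for v = u - (u - v). The coefficient of the energy of u tends to 1 as l
    tends to 1, and for fixed l the distance term is small with the distance. *)
Lemma energy_le_weighted (l : R) (u v : circle R -> circle R) : 0 < l < 1 ->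
  circle_measurable u -> circle_measurable v ->
  (energy p v <= (l `^ (1 - p))%:E * energy p u +
     ((1 - l) `^ (1 - p))%:E * W_dist p u v)%E.
Proof.
move=> l01 mu mv.
have ReB (z w : R[i]) : complex.Re (z - w) = complex.Re z - complex.Re w.
  by case: z; case: w.
have ImB (z w : R[i]) : complex.Im (z - w) = complex.Im z - complex.Im w.
  by case: z; case: w.
pose w (x : circle R) : R[i] := val (u x) - val (v x).
have md : lebesgue_measurable_map w.
  case: mu mv => [uR uI] [vR vI]; split.
    have := measurable_funB uR vR; congr (measurable_fun _ _); apply/funext => t.
    by rewrite ReB.
  have := measurable_funB uI vI; congr (measurable_fun _ _); apply/funext => t.
  by rewrite ImB.
apply: (@le_trans _ _ ((l `^ (1 - p))%:E * energy p u +
   ((1 - l) `^ (1 - p))%:E * gagliardo p w)%E).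
  apply: (gagliardo_le_weighted l (fun x => val (v x)) (fun x => val (u x)) w) => // x y.
  have -> : val (v x) - val (v y) = (val (u x) - val (u y)) -
    (w x - w y) :> R[i] by rewrite /w; ring.
  by rewrite -(normcN (w x - w y)) le_normcD.
rewrite leeD2l // lee_wpmul2l ?lee_fin ?powR_ge0 //.
rewrite /W_dist -[leLHS]add0e leeD2r //.
by apply: integral_ge0 => t _; rewrite lee_fin powR_ge0.
Qed.

End perturbation.

Lemma is_degree_measurable (R : realType) (v : circle R -> circle R) (d : int) :
  is_degree v d -> circle_measurable v.
Proof.
case=> phi [cphi vphi _].
have mphi : measurable_fun setT phi by exact: continuous_measurable_fun.
split; apply: measurable_lebesgueR => //.
  have -> : (fun t => complex.Re (val (v (expi t)))) = (fun t => cos (phi t)).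
    by apply/funext => t; rewrite vphi.
  by apply: (measurableT_comp _ mphi); apply: continuous_measurable_fun; exact: continuous_cos.
have -> : (fun t => complex.Im (val (v (expi t)))) = (fun t => sin (phi t)).
  by apply/funext => t; rewrite vphi.
by apply: (measurableT_comp _ mphi); apply: continuous_measurable_fun; exact: continuous_sin.
Qed.

Theorem mainTheorem2 (R : realType) (p : R) (u : circle R -> circle R)
    (hp1 : 1 < p) (hp2 : p < 2) (hu : W_circle p u) :
  ((`|vmo_degree p u|%:~R : R)%:E <=
     ((p - 1) / (4 * pi))%:E * energy p u)%E.
Proof.
have pi0 := pi_gt0 R; have pp : 0 < p - 1 by rewrite subr_gt0.
have pi4 : 0 < 4 * pi :> R by rewrite mulr_gt0.
case: hu => mu Efin.
have E0 : (0 <= energy p u)%E by exact: gagliardo_ge0.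
have EE : energy p u = (fine (energy p u))%:E by rewrite fineK // ge0_fin_numE.
rewrite EE -EFinM lee_fin; set E := fine _ in EE *.
have E00 : 0 <= E by rewrite -lee_fin -EE.
(* If no integer is a degree, [xget] returns 0 and the bound is trivial. *)
rewrite /vmo_degree; case: xgetP => [d _ [approx [e1 e10 stable]]|_]; last first.
  by rewrite normr0 mulr0z mulr_ge0 // divr_ge0 // ltW.
rewrite intr_norm mulrAC ler_pdivlMr // [_ * (4 * pi)]mulrC.
set D := 4 * pi * _.
have D0 : 0 <= D by rewrite mulr_ge0 // ltW.
have approx_bound (l e2 : R) : 0 < l < 1 -> 0 < e2 ->
    D <= (p - 1) * (l `^ (1 - p) * E + (1 - l) `^ (1 - p) * e2).
  move=> l01 e20.
  (* [e1] ensures that v has degree d, and [e2] bounds the distance term. *)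
  have m0 : 0 < Num.min e1 e2 by rewrite lt_min e10.
  have [v sv vd] := approx _ m0.
  have vdeg : is_degree v d.
    by apply: stable => //; apply: (lt_le_trans vd); rewrite lee_fin ge_min lexx.
  have := degree_bound _ _ _ _ hp1 vdeg.
  have := energy_le_weighted _ p hp1 l u v l01 mu (is_degree_measurable _ _ _ vdeg).
  rewrite -/D EE => h1 h2; rewrite -lee_fin; apply: (le_trans h2).
  rewrite EFinM lee_wpmul2l ?lee_fin ?(ltW pp) //; apply: (le_trans h1).
  rewrite EFinD !EFinM leeD2l // lee_wpmul2l ?lee_fin ?powR_ge0 //.
  by apply: (le_trans (ltW vd)); rewrite lee_fin ge_min lexx orbT.
(* For fixed l the distance term is sent to 0; then l <= l^(p-1), valid because p - 1 <= 1, gives a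
   factor linear in l. *)
have weighted l : 0 < l < 1 -> l * D <= (p - 1) * E.
  move=> /[dup] l01 /andP[l0 l1].
  have h : D <= (p - 1) * (l `^ (1 - p) * E).
    apply/ler_addgt0Pr => eta eta0.
    have q0 : 0 < (1 - l) `^ (1 - p) by rewrite powR_gt0 // subr_gt0.
    have := approx_bound l (eta / ((p - 1) * (1 - l) `^ (1 - p))) l01.
    rewrite divr_gt0 // ?mulr_gt0 // => /(_ isT) h; apply: (le_trans h).
    rewrite mulrDr lerD2l mulrA mulrCA divff ?mulr1 // gt_eqF // mulr_gt0 //.
  have lp : l <= l `^ (p - 1) by apply: ger1_powR; rewrite ?l0 ?ltW //; lra.
  apply: (@le_trans _ _ (l `^ (p - 1) * D)); first by rewrite ler_wpM2r.
  apply: (le_trans (ler_wpM2l (powR_ge0 _ _) h)).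
  have -> : 1 - p = - (p - 1) by ring.
  have q0 : l `^ (p - 1) != 0 by rewrite gt_eqF // powR_gt0.
  rewrite powRN le_eqVlt; apply/orP; left; apply/eqP.
  by move: (l `^ (p - 1)) q0 => q q0; field.
apply/ler_addgt0Pr => eta eta0.
have D1 : 0 < D + eta + 1 by lra.
(* With this l the loss (1 - l) D is at most eta; the summand 1 keeps l positive even when D = 0. *)
have := weighted (1 - eta / (D + eta + 1)).
have q : 0 < eta / (D + eta + 1) < 1.
  by rewrite divr_gt0 //= ltr_pdivrMr // mul1r; lra.
move=> /(_ _)/wrap[]; first by lra.
rewrite mulrBl mul1r lerBlDr => /le_trans; apply.
rewrite lerD2l mulrAC ler_pdivrMr //; nra.
Qed.
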